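(* For all positive integers $m$ and $p$, $$(-1)^m \sum_{j=1}^p W(2j+2m-1,2m)\,Z(j,p)=(-1)^p \sum_{j=1}^m W(2j+2p-1,2p)\,Z(j,m).$$
   Context: For positive integers $k_1,\dots,k_r$ the alternating multiple $T$-value is $\bar T(k_1,\ldots,k_r):=2^r\sum_{0<n_1<\cdots<n_r}\frac{(-1)^{n_r}}{(2n_1-1)^{k_1}(2n_2-2)^{k_2}\cdots(2n_r-r)^{k_r}}$ (conditionally convergent series), with $\bar T(\emptyset):=1$. $I(k,r)$ denotes the set of tuples $(k_1,\dots,k_r)$ of positive integers with $k_1+\cdots+k_r=k$. For a positive integer $m$, $W_m(k,r):=\sum_{(k_1,\dots,k_r)\in I(k,r)}\binom{k_r+m-2}{m-1}\bar T(k_1,\ldots,k_{r-1},k_r+m-1)$, and $W(k,r):=W_1(k,r)=\sum_{(k_1,\dots,k_r)\in I(k,r)}\bar T(k_1,\dots,k_r)$. $\bar\zeta(s):=\sum_{n\ge1}(-1)^{n-1}n^{-s}$ for integers $s\ge1$, and $\bar\zeta(0):=1/2$. For integers $1\le j\le p$: $Z(p,p):=1$ and, for $j<p$, $Z(j,p):=\sum_{k=1}^{p-j}(-2)^k\sum_{j=i_0<i_1<\cdots<i_{k-1}<i_k=p}\ \prod_{l=1}^k\bar\zeta(2i_l-2i_{l-1})$ (inner sum over integers $i_1<\dots<i_{k-1}$ strictly between $j$ and $p$). *)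

(* Defs.v *)
From Stdlib Require Import Reals List Arith.
From Coquelicot Require Import Coquelicot.
Import ListNotations.
Open Scope R_scope.

Definition Rsum_list (l : list R) : R := fold_right Rplus 0 l.

Fixpoint incr_lists (len lo hi : nat) : list (list nat) :=
  match len with
  | O => [ [] ]
  | S l => flat_map (fun a => map (cons a) (incr_lists l (S a) hi))
                    (seq lo (S hi - lo))
  end.

Fixpoint compositions (r k : nat) : list (list nat) :=
  match r with
  | O => if Nat.eqb k 0 then [ [] ] else []
  | S r' => flat_map (fun a => map (cons a) (compositions r' (k - a)))
                     (seq 1 k)
  end.

Fixpoint Tbar_prod (i0 : nat) (ks ns : list nat) : R :=
  match ks, ns with
  | k :: ks', n :: ns' =>
      / (2 * INR n - INR i0) ^ k * Tbar_prod (S i0) ks' ns'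
  | _, _ => 1
  end.

Definition Tbar_partial (ks : list nat) (N : nat) : R :=
  2 ^ length ks *
  Rsum_list (map (fun ns => (-1) ^ (last ns O) * Tbar_prod 1 ks ns)
                 (incr_lists (length ks) 1 N)).

(* alternating multiple T-value (value of the conditionally convergent series,
   summed with outer index n_r; Tbar(empty) = 1) *)
Definition Tbar (ks : list nat) : R :=
  match ks with
  | [] => 1
  | _ => real (Lim_seq (Tbar_partial ks))
  end.

Definition W (k r : nat) : R := Rsum_list (map Tbar (compositions r k)).

Definition zetabar (s : nat) : R :=
  match s with
  | O => / 2
  | _ => real (Lim_seq (fun N =>
           Rsum_list (map (fun n => (-1) ^ (n - 1) / INR n ^ s) (seq 1 N))))
  end.

Fixpoint chain_prod (prev : nat) (l : list nat) : R :=
  match l with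
  | [] => 1
  | x :: l' => zetabar (2 * x - 2 * prev) * chain_prod x l'
  end.

Definition Zjp (j p : nat) : R :=
  if Nat.eqb j p then 1
  else Rsum_list (map (fun k =>
         (-2) ^ k *
         Rsum_list (map (fun mids => chain_prod j (mids ++ [p]))
                        (incr_lists (k - 1) (S j) (p - 1))))
       (seq 1 (p - j))).

(* W_m(k,r) = sum_{I(k,r)} binom(k_r+m-2, m-1) Tbar(k_1,..,k_{r-1},k_r+m-1)
   (general version, not needed for the statement since W = W_1) *)
Definition W_m (m k r : nat) : R :=
  Rsum_list (map (fun ks =>
     let kr := last ks O in
     Binomial.C (kr + m - 2) (m - 1) *
     Tbar (removelast ks ++ [kr + m - 1]%nat)) (compositions r k)).

(* Main.v *)
Require Import Defs.
From Stdlib Require Import Reals List Arith Lra Lia.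
From Coquelicot Require Import Coquelicot.
Import ListNotations.
Open Scope R_scope.

(** Let [v = gd w] be the Gudermannian function, so that [dv = dw / cosh w].  Shuffling the iterated
    integrals of the [T]-values turns [W (A + B) B] into [(-1)^B] times the integral over [w > 0] of
    [w^A / A! * v^(B-1) / (B-1)! dv].  The numbers [Z(j,p)] are the Taylor coefficients of
    [sin (pi x) / (pi x)]; hence [(-1)^(m-1) v^(2m-1) / (2m-1)!] is the combination with coefficients
    [Z(i,m)] of the Fourier series [2 sum_n (-1)^(n-1) sin (n v) / n^(2i-1)].  By the Poisson kernel
    the [i]-th series is [cosh w] times the integral over [t > 0] of
    [t^(2i-1) / (2i-1)! * kappa t w], where [kappa t w = sinh t sinh w / (cosh t cosh w + 1)^2] is
    symmetric.  So the left-hand side is minus the sum over [i <= m], [j <= p] of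
    [Z(i,m) Z(j,p)] times the double moments of [kappa], and Fubini makes it symmetric.
    All improper integrals and series are truncated at the same [N]. *)

(** * Finite sums and truncated chain sums *)

(** The series for the T-values converge only conditionally, so sums and integrals cannot be
    exchanged termwise in the limit. Under the common truncation every exchange takes place between
    finite sums and integrals of continuous functions over [0, N], and each defect is a boundary
    term or a tail that tends to 0. Crude bounds suffice for the defects: a chain sum is at most a
    multiple of sqrt N, which a factor 1/N absorbs.

    No shuffle product is ever formed. It is replaced by a differential equation: a suitable
    combination of truncated series of depth B + 1 has derivative 1 / cosh w times the one of depth
    B, and integration by parts trades each unit of depth for a power of v.

    Since v stays in [0, pi/2], it keeps away from the jump of the sawtooth series at v = pi, so the
    Fourier errors are uniform in w; against the weight w^A / cosh w they integrate to something
    small. The sine function behind Z(j,p) never enters: the recursion of these coefficients is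
    exactly what cancels the constant terms when the Fourier identity is integrated twice. *)

Fixpoint bsum (n : nat) (f : nat -> R) : R :=
  match n with O => 0 | S n' => bsum n' f + f n' end.

Lemma bsum_S n f : bsum (S n) f = bsum n f + f n.
Proof. reflexivity. Qed.

Lemma bsum_ext n f g : (forall i, (i < n)%nat -> f i = g i) -> bsum n f = bsum n g.
Proof.
  induction n as [|n IH]; intros H; simpl; [reflexivity|].
  rewrite IH, (H n); [reflexivity|lia|intros; apply H; lia].
Qed.

Lemma bsum_plus n f g : bsum n (fun i => f i + g i) = bsum n f + bsum n g.
Proof. induction n as [|n IH]; simpl; [ring|rewrite IH; ring]. Qed.

Lemma bsum_minus n f g : bsum n (fun i => f i - g i) = bsum n f - bsum n g.
Proof. induction n as [|n IH]; simpl; [ring|rewrite IH; ring]. Qed.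

Lemma bsum_scal n c f : bsum n (fun i => c * f i) = c * bsum n f.
Proof. induction n as [|n IH]; simpl; [ring|rewrite IH; ring]. Qed.

Lemma bsum_zero n f : (forall i, (i < n)%nat -> f i = 0) -> bsum n f = 0.
Proof.
  induction n as [|n IH]; intros H; simpl; [reflexivity|].
  rewrite IH, (H n); [ring|lia|intros; apply H; lia].
Qed.

Lemma bsum_le n f g : (forall i, (i < n)%nat -> f i <= g i) -> bsum n f <= bsum n g.
Proof.
  induction n as [|n IH]; intros H; simpl; [lra|].
  apply Rplus_le_compat; [apply IH; intros; apply H; lia|apply H; lia].
Qed.

Lemma bsum_nonneg n f : (forall i, (i < n)%nat -> 0 <= f i) -> 0 <= bsum n f.
Proof.
  intros H; rewrite <- (bsum_zero n (fun _ => 0)); [now apply bsum_le|reflexivity].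
Qed.

Lemma bsum_Rabs n f : Rabs (bsum n f) <= bsum n (fun i => Rabs (f i)).
Proof.
  induction n as [|n IH]; simpl; [rewrite Rabs_R0; lra|].
  eapply Rle_trans; [apply Rabs_triang|lra].
Qed.

Lemma bsum_const n c : bsum n (fun _ => c) = INR n * c.
Proof. induction n as [|n IH]; [simpl; ring|]. rewrite S_INR, bsum_S, IH; ring. Qed.

Lemma bsum_S_l n f : bsum (S n) f = f O + bsum n (fun i => f (S i)).
Proof. induction n as [|n IH]; [simpl; ring|]. rewrite bsum_S, IH; simpl; ring. Qed.

Lemma bsum_swap n m f :
  bsum n (fun i => bsum m (fun j => f i j)) = bsum m (fun j => bsum n (fun i => f i j)).
Proof.
  induction n as [|n IH]; simpl.
  - now rewrite bsum_zero.
  - now rewrite IH, <- bsum_plus.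
Qed.

Lemma bsum_tail_zero n m f : (n <= m)%nat ->
  (forall i, (n <= i < m)%nat -> f i = 0) -> bsum m f = bsum n f.
Proof.
  intros Hnm; induction m as [|m IH]; intros H.
  - now replace n with O by lia.
  - destruct (Nat.eq_dec n (S m)) as [->|Hn]; [reflexivity|].
    simpl; rewrite IH, (H m); [ring|lia|lia|intros; apply H; lia].
Qed.

Lemma bsum_telescope n f : bsum n (fun i => f (S i) - f i) = f n - f O.
Proof. induction n as [|n IH]; simpl; [ring|rewrite IH; ring]. Qed.

Lemma is_lim_seq_bsum n (f : nat -> nat -> R) (l : nat -> R) :
  (forall i, (i < n)%nat -> is_lim_seq (f i) (l i)) ->
  is_lim_seq (fun N => bsum n (fun i => f i N)) (bsum n l).
Proof.
  induction n as [|n IH]; intros H; simpl; [apply is_lim_seq_const|].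
  apply (is_lim_seq_plus' _ _ (bsum n l) (l n)); [apply IH; intros; apply H; lia|apply H; lia].
Qed.

Lemma is_derive_bsum n (f : nat -> R -> R) (df : nat -> R) x :
  (forall i, (i < n)%nat -> is_derive (f i) x (df i)) ->
  is_derive (fun y => bsum n (fun i => f i y)) x (bsum n df).
Proof.
  induction n as [|n IH]; intros H; simpl; [apply (is_derive_const 0)|].
  apply (is_derive_plus (fun y => bsum n (fun i => f i y)) (f n));
    [apply IH; intros; apply H; lia|apply H; lia].
Qed.

Lemma is_RInt_bsum n (f : nat -> R -> R) (I : nat -> R) a b :
  (forall i, (i < n)%nat -> is_RInt (f i) a b (I i)) ->
  is_RInt (fun y => bsum n (fun i => f i y)) a b (bsum n I).
Proof.
  induction n as [|n IH]; intros H; simpl.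
  - generalize (is_RInt_const a b (0 : R)).
    unfold scal; simpl; unfold mult; simpl; now rewrite Rmult_0_r.
  - apply (is_RInt_plus (fun y => bsum n (fun i => f i y)) (f n));
      [apply IH; intros; apply H; lia|apply H; lia].
Qed.

(** * Sums over lists, chains of indices and compositions *)

Lemma Rsum_list_app l1 l2 : Rsum_list (l1 ++ l2) = Rsum_list l1 + Rsum_list l2.
Proof. unfold Rsum_list; induction l1 as [|x l1 IH]; simpl; [ring|rewrite IH; ring]. Qed.

Lemma Rsum_list_scal {T} c (f : T -> R) l :
  Rsum_list (map (fun x => c * f x) l) = c * Rsum_list (map f l).
Proof. unfold Rsum_list; induction l as [|x l IH]; simpl; [ring|rewrite IH; ring]. Qed.

Lemma Rsum_list_ext {T} (f g : T -> R) l :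
  (forall x, In x l -> f x = g x) -> Rsum_list (map f l) = Rsum_list (map g l).
Proof.
  intros H; f_equal; apply map_ext_in; assumption.
Qed.

Lemma Rsum_list_plus {T} (f g : T -> R) l :
  Rsum_list (map (fun x => f x + g x) l) = Rsum_list (map f l) + Rsum_list (map g l).
Proof. unfold Rsum_list; induction l as [|x l IH]; simpl; [ring|rewrite IH; ring]. Qed.

Lemma Rsum_list_flat_map {T U} (F : U -> R) (g : T -> list U) l :
  Rsum_list (map F (flat_map g l)) = Rsum_list (map (fun a => Rsum_list (map F (g a))) l).
Proof.
  induction l as [|x l IH]; simpl; [reflexivity|].
  rewrite map_app, Rsum_list_app, IH; reflexivity.
Qed.

Lemma Rsum_list_seq (f : nat -> R) a n :
  Rsum_list (map f (seq a n)) = bsum n (fun i => f (a + i)%nat).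
Proof.
  induction n as [|n IH]; [reflexivity|].
  rewrite seq_S, map_app, Rsum_list_app, IH; simpl; unfold Rsum_list; simpl; ring.
Qed.

Lemma is_lim_seq_Rsum_list {T} (f : T -> nat -> R) (l : T -> R) (s : list T) :
  (forall x, In x s -> is_lim_seq (f x) (l x)) ->
  is_lim_seq (fun N => Rsum_list (map (fun x => f x N) s)) (Rsum_list (map l s)).
Proof.
  induction s as [|x s IH]; intros H; simpl.
  - apply is_lim_seq_const.
  - apply (is_lim_seq_plus' _ _ (l x) (Rsum_list (map l s))).
    + apply H; now left.
    + apply IH; intros; apply H; now right.
Qed.

(** The enumeration is built from the innermost index, while the truncation bounds the outermost
    one; the chains ending in [S hi] are therefore split off by induction on the length. The bound
    on [lo] makes [[S hi]] itself an admissible chain when [l] is 0. *)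
Lemma incr_lists_S l lo hi (F : list nat -> R) : (lo <= S hi)%nat ->
  Rsum_list (map F (incr_lists (S l) lo (S hi))) =
  Rsum_list (map F (incr_lists (S l) lo hi)) +
  Rsum_list (map (fun ns => F (ns ++ [S hi])) (incr_lists l lo hi)).
Proof.
  revert lo F; induction l as [|l IH]; intros lo F Hlo.
  - cbn [incr_lists]; rewrite !Rsum_list_flat_map.
    replace (S (S hi) - lo)%nat with (S (S hi - lo)) by lia.
    rewrite seq_S, map_app, Rsum_list_app.
    replace (lo + (S hi - lo))%nat with (S hi) by lia.
    f_equal; unfold Rsum_list; simpl; ring.
  - remember (S l) as l1 eqn:El1.
    cbn [incr_lists]. rewrite Rsum_list_flat_map.
    replace (S (S hi) - lo)%nat with (S (S hi - lo)) by lia.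
    rewrite seq_S, map_app, Rsum_list_app.
    replace (lo + (S hi - lo))%nat with (S hi) by lia.
    assert (E0 : incr_lists l1 (S (S hi)) (S hi) = [])
      by (rewrite El1; cbn [incr_lists]; rewrite Nat.sub_diag; reflexivity).
    cbn [map]; rewrite E0.
    change (Rsum_list [Rsum_list (map F (map (cons (S hi)) []))]) with (0 + 0).
    rewrite (Rsum_list_ext _ (fun a =>
       Rsum_list (map F (map (cons a) (incr_lists l1 (S a) hi))) +
       Rsum_list (map (fun ns => F (ns ++ [S hi])) (map (cons a) (incr_lists l (S a) hi))))).
    + rewrite Rsum_list_plus, <- !Rsum_list_flat_map.
      rewrite Rplus_0_l, Rplus_0_r. f_equal. now rewrite El1.
    + intros a Ha; apply in_seq in Ha.
      rewrite !map_map; apply (IH (S a) (fun ns => F (a :: ns))); lia.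
Qed.

(* [rks] lists the exponents in reverse order, so that the recursion is on the outermost index. *)
Fixpoint chain_sum (rks : list nat) (N : nat) : R :=
  match rks with
  | [] => 1
  | k :: t => bsum N (fun i => chain_sum t i / (2 * INR (S i) - INR (S (length t))) ^ k)
  end.

Lemma incr_lists_length l lo hi ns : In ns (incr_lists l lo hi) -> length ns = l.
Proof.
  revert lo ns; induction l as [|l IH]; intros lo ns H; simpl in H.
  - destruct H as [<-|[]]; reflexivity.
  - apply in_flat_map in H as [a [_ H]]; apply in_map_iff in H as [ns' [<- H]].
    simpl; f_equal; eapply IH; eassumption.
Qed.

Lemma Tbar_prod_snoc i0 ks ns k n : length ks = length ns ->
  Tbar_prod i0 (ks ++ [k]) (ns ++ [n]) =
  Tbar_prod i0 ks ns / (2 * INR n - INR (i0 + length ks)) ^ k.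
Proof.
  revert i0 ns; induction ks as [|k' ks IH]; intros i0 [|n' ns] H; try discriminate.
  - simpl; rewrite Nat.add_0_r; unfold Rdiv; ring.
  - injection H as H. cbn [Tbar_prod app length]. rewrite (IH (S i0) ns H).
    replace (i0 + S (length ks))%nat with (S i0 + length ks)%nat by lia.
    unfold Rdiv; ring.
Qed.

(** The weight [w] on the outermost index allows one induction to serve both the plain chain sums
    (weight 1) and the alternating partial sums (weight (-1)^n). The premise is the induction
    hypothesis of the first use. *)
Lemma incr_lists_chain_sum ks k (w : nat -> R) N :
  (forall M, Rsum_list (map (Tbar_prod 1 ks) (incr_lists (length ks) 1 M)) = chain_sum (rev ks) M) ->
  Rsum_list (map (fun ns => w (last ns O) * Tbar_prod 1 (ks ++ [k]) ns)
                 (incr_lists (S (length ks)) 1 N)) =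
  bsum N (fun i => w (S i) * (chain_sum (rev ks) i / (2 * INR (S i) - INR (S (length ks))) ^ k)).
Proof.
  intros H; induction N as [|N IH].
  - reflexivity.
  - rewrite incr_lists_S by lia. rewrite IH, bsum_S. f_equal.
    rewrite <- H. unfold Rdiv. rewrite (Rmult_comm (Rsum_list _)), <- Rmult_assoc, <- Rsum_list_scal.
    apply Rsum_list_ext; intros ns Hns.
    rewrite last_last, Tbar_prod_snoc by (symmetry; eapply incr_lists_length; eassumption).
    change (1 + length ks)%nat with (S (length ks)).
    unfold Rdiv; ring.
Qed.

Lemma Tbar_prod_chain_sum ks M :
  Rsum_list (map (Tbar_prod 1 ks) (incr_lists (length ks) 1 M)) = chain_sum (rev ks) M.
Proof.
  revert M; induction ks as [|k ks IH] using rev_ind; intros M.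
  - unfold Rsum_list; simpl; ring.
  - rewrite length_app, Nat.add_1_r, rev_app_distr; cbn [chain_sum rev app length]. rewrite length_rev.
    rewrite (Rsum_list_ext _ (fun ns => 1 * Tbar_prod 1 (ks ++ [k]) ns)) by (intros; ring).
    rewrite (incr_lists_chain_sum ks k (fun _ => 1) M IH).
    apply bsum_ext; intros; ring.
Qed.

Lemma Tbar_partial_snoc ks k N :
  Tbar_partial (ks ++ [k]) N =
  bsum N (fun i => (-1) ^ S i * (2 ^ S (length ks) *
     (chain_sum (rev ks) i / (2 * INR (S i) - INR (S (length ks))) ^ k))).
Proof.
  unfold Tbar_partial. rewrite length_app, Nat.add_1_r.
  rewrite (incr_lists_chain_sum ks k (fun n => (-1) ^ n) N (Tbar_prod_chain_sum ks)).
  rewrite <- bsum_scal; apply bsum_ext; intros; ring.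
Qed.

Lemma in_compositions r k ks : In ks (compositions r k) ->
  length ks = r /\ (r <= k)%nat /\ (forall a, In a ks -> (1 <= a)%nat).
Proof.
  revert k ks; induction r as [|r IH]; intros k ks H; cbn [compositions] in H.
  - destruct (Nat.eqb k 0); [|destruct H].
    destruct H as [<-|[]]; repeat split; [lia|intros a []].
  - apply in_flat_map in H as [a [Ha H]]; apply in_map_iff in H as [ks' [<- H]].
    apply in_seq in Ha; destruct (IH _ _ H) as [H1 [H2 H3]].
    repeat split; [simpl; congruence|lia|].
    intros b [<-|Hb]; [lia|now apply H3].
Qed.

Lemma compositions_nil r k : (k < r)%nat -> compositions r k = [].
Proof.
  intros H; destruct (compositions r k) as [|ks l] eqn:E; [reflexivity|].
  destruct (in_compositions r k ks) as [_ [H1 _]]; [rewrite E; now left|lia].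
Qed.

Lemma bsum_triangle k (h : nat -> nat -> R) :
  bsum k (fun i => bsum (k - S i) (fun j => h i j)) =
  bsum k (fun j => bsum (k - S j) (fun i => h i j)).
Proof.
  (* The triangle i + j + 1 < k is written as a full square with an indicator, where the two sums
     commute. *)
  assert (E : forall g : nat -> nat -> R, bsum k (fun i => bsum (k - S i) (fun j => g i j)) =
     bsum k (fun i => bsum k (fun j => if (S i + j <? k)%nat then g i j else 0))).
  { intros g; apply bsum_ext; intros i Hi.
    rewrite (bsum_tail_zero (k - S i) k); [|lia|].
    - apply bsum_ext; intros j Hj; destruct (Nat.ltb_spec (S i + j) k); [reflexivity|lia].
    - intros j Hj; destruct (Nat.ltb_spec (S i + j) k); [lia|reflexivity]. }
  rewrite E, (E (fun j i => h i j)), bsum_swap.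
  apply bsum_ext; intros i Hi; apply bsum_ext; intros j Hj.
  now rewrite (Nat.add_succ_comm j i), (Nat.add_comm j (S i)).
Qed.

Lemma compositions_S_l r k (F : list nat -> R) :
  Rsum_list (map F (compositions (S r) k)) =
  bsum k (fun i => Rsum_list (map (fun ks => F (S i :: ks)) (compositions r (k - S i)))).
Proof.
  cbn [compositions]; rewrite Rsum_list_flat_map, Rsum_list_seq.
  apply bsum_ext; intros i _; now rewrite map_map.
Qed.

(** Compositions are generated by their first part, but the recursion of [chain_sum] consumes the
    last exponent; exchanging the sums over the first and the last part converts one description
    into the other. *)
Lemma compositions_S_r r k (F : list nat -> R) :
  Rsum_list (map F (compositions (S r) k)) =
  bsum k (fun i => Rsum_list (map (fun ks => F (ks ++ [S i])) (compositions r (k - S i)))).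
Proof.
  revert k F; induction r as [|r IH]; intros k F.
  - rewrite compositions_S_l; apply bsum_ext; intros i _.
    cbn [compositions]; destruct (Nat.eqb (k - S i) 0); reflexivity.
  - rewrite compositions_S_l.
    rewrite (bsum_ext k _ (fun i => bsum (k - S i) (fun j => Rsum_list
      (map (fun ks => F (S i :: ks ++ [S j])) (compositions r (k - S i - S j))))))
      by (intros; apply IH).
    rewrite bsum_triangle; apply bsum_ext; intros j _.
    rewrite compositions_S_l; apply bsum_ext; intros i _.
    now replace (k - S i - S j)%nat with (k - S j - S i)%nat by lia.
Qed.

Lemma Rsum_list_bsum {T} N (f : T -> nat -> R) l :
  Rsum_list (map (fun x => bsum N (f x)) l) = bsum N (fun i => Rsum_list (map (fun x => f x i) l)).
Proof.
  induction l as [|x l IH]; simpl.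
  - rewrite bsum_zero; reflexivity.
  - now rewrite (bsum_plus N (f x)), <- IH.
Qed.

(* [comp_sum B A N] is [2^B] times the sum of [chain_sum _ N] over all compositions of [A + B] into
   [B] parts; [comp_term B A i] is the contribution of [n_(B+1) = i + 1] at depth [B + 1]. *)
Fixpoint comp_sum (B A N : nat) : R :=
  match B with
  | O => if (A =? 0)%nat then 1 else 0
  | S B' => bsum N (fun i => bsum (S A) (fun a =>
              2 * comp_sum B' (A - a) i / (2 * INR (S i) - INR (S B')) ^ S a))
  end.

Definition comp_term (B A i : nat) : R :=
  bsum (S A) (fun a => 2 * comp_sum B (A - a) i / (2 * INR (S i) - INR (S B)) ^ S a).

Lemma comp_sum_S B A N : comp_sum (S B) A N = bsum N (comp_term B A).
Proof. reflexivity. Qed.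

(** Again one statement for two weights [c] on the outermost index: constant 1 for the induction on
    the depth, alternating signs for the T-values. *)
Lemma compositions_weighted B A N (c : nat -> R) (G : list nat -> R) :
  (forall A' M, Rsum_list (map (fun ks => 2 ^ B * chain_sum (rev ks) M) (compositions B (A' + B)))
     = comp_sum B A' M) ->
  (forall ks k, length ks = B -> G (ks ++ [k]) = bsum N (fun i => c i * (2 ^ S B *
     (chain_sum (rev ks) i / (2 * INR (S i) - INR (S B)) ^ k)))) ->
  Rsum_list (map G (compositions (S B) (A + S B))) = bsum N (fun i => c i * comp_term B A i).
Proof.
  (* A last part larger than A + 1 leaves less than B for the remaining B parts, so the sum over the
     last part stops at [S A]. *)
  intros HX HG; rewrite compositions_S_r, (bsum_tail_zero (S A)).
  - rewrite (bsum_ext (S A) _ (fun a => bsum N (fun i =>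
      c i * (2 * comp_sum B (A - a) i / (2 * INR (S i) - INR (S B)) ^ S a)))).
    + rewrite bsum_swap; apply bsum_ext; intros i _; now rewrite bsum_scal.
    + intros a Ha.
      replace (A + S B - S a)%nat with ((A - a) + B)%nat by lia.
      rewrite (Rsum_list_ext _ (fun ks => bsum N (fun i => c i * (2 ^ S B *
        (chain_sum (rev ks) i / (2 * INR (S i) - INR (S B)) ^ S a))))).
      * rewrite Rsum_list_bsum; apply bsum_ext; intros i _.
        rewrite <- (HX (A - a)%nat i).
        rewrite (Rsum_list_ext _ (fun ks => (c i * 2 * / (2 * INR (S i) - INR (S B)) ^ S a) *
          (2 ^ B * chain_sum (rev ks) i))).
        -- rewrite Rsum_list_scal; unfold Rdiv; ring.
        -- intros ks _. rewrite <- tech_pow_Rmult; unfold Rdiv; ring.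
      * intros ks Hks; apply HG; now apply in_compositions in Hks as [H _].
  - lia.
  - intros i Hi; rewrite compositions_nil by lia; reflexivity.
Qed.

Lemma compositions_chain_sum B A N :
  Rsum_list (map (fun ks => 2 ^ B * chain_sum (rev ks) N) (compositions B (A + B))) = comp_sum B A N.
Proof.
  revert A N; induction B as [|B IH]; intros A N.
  - cbn [compositions comp_sum]; rewrite Nat.add_0_r; destruct (Nat.eqb A 0);
      unfold Rsum_list; simpl; ring.
  - rewrite (compositions_weighted B A N (fun _ => 1)).
    + rewrite comp_sum_S; apply bsum_ext; intros; ring.
    + exact IH.
    + intros ks k Hk; rewrite rev_app_distr; cbn [chain_sum rev app length]; rewrite length_rev, Hk.
      rewrite <- bsum_scal; apply bsum_ext; intros; simpl; ring.
Qed.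

Lemma compositions_Tbar_partial B A N :
  Rsum_list (map (fun ks => Tbar_partial ks N) (compositions (S B) (A + S B))) =
  bsum N (fun i => (-1) ^ S i * comp_term B A i).
Proof.
  apply compositions_weighted; [apply compositions_chain_sum|].
  intros ks k Hk; rewrite Tbar_partial_snoc, Hk; reflexivity.
Qed.

(** * Growth of chain sums and convergence of the T-series *)

Lemma chain_sum_nonneg_zero rks :
  (forall N, 0 <= chain_sum rks N) /\ (forall N, (N < length rks)%nat -> chain_sum rks N = 0).
Proof.
  (* The two claims need each other: a denominator 2 n - r may be zero or negative while n is below
     the depth, and nonnegativity survives because the inner chain sum vanishes there. *)
  induction rks as [|k t [IH1 IH2]]; cbn [chain_sum rev app length].
  - split; [intros; lra|simpl; intros; lia].
  - split; intros N.
    + apply bsum_nonneg; intros i _.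
      destruct (le_lt_dec (length t) i) as [Hi|Hi].
      * apply Rle_mult_inv_pos; [apply IH1|]. apply pow_lt.
        assert (H := le_INR _ _ Hi); assert (H2 := pos_INR i); rewrite !S_INR; lra.
      * rewrite IH2 by assumption; unfold Rdiv; lra.
    + intros HN; apply bsum_zero; intros i Hi. rewrite IH2 by (simpl in HN; lia).
      unfold Rdiv; ring.
Qed.

Lemma chain_sum_nonneg rks N : 0 <= chain_sum rks N.
Proof. apply chain_sum_nonneg_zero. Qed.

Lemma chain_sum_zero rks N : (N < length rks)%nat -> chain_sum rks N = 0.
Proof. apply chain_sum_nonneg_zero. Qed.

Lemma inv_pow_le_inv d x k : 0 < x <= d -> 1 <= x -> (1 <= k)%nat -> 0 < / d ^ k <= / x.
Proof.
  intros [Hx Hd] H1 Hk; split; [apply Rinv_0_lt_compat, pow_lt; lra|].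
  apply Rinv_le_contravar; [lra|].
  apply Rle_trans with (d ^ 1); [simpl; lra|]. apply Rle_pow; [lra|assumption].
Qed.

Lemma index_le_odd_denominator i r : (r <= i)%nat ->
  0 < INR (S i) <= 2 * INR (S i) - INR (S r).
Proof.
  intros H; apply le_INR in H; assert (H2 := pos_INR i); rewrite !S_INR; lra.
Qed.

Lemma one_le_INR_S i : 1 <= INR (S i).
Proof. rewrite S_INR; assert (H := pos_INR i); lra. Qed.

Lemma chain_term_le t k i : (1 <= k)%nat ->
  chain_sum t i / (2 * INR (S i) - INR (S (length t))) ^ k <= chain_sum t i / INR (S i).
Proof.
  intros Hk; destruct (le_lt_dec (length t) i) as [Hi|Hi].
  - apply Rmult_le_compat_l; [apply chain_sum_nonneg|].
    apply inv_pow_le_inv; [now apply index_le_odd_denominator|apply one_le_INR_S|assumption].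
  - rewrite chain_sum_zero by assumption; unfold Rdiv; lra.
Qed.

(** With x = sqrt n and y = sqrt (n - 1), the product (x - y)(x + y) is 1 and x + y <= 2 x. The
    right-hand side telescopes. *)
Lemma inv_sqrt_le_diff i : sqrt (INR (S i)) / INR (S i) <= 2 * (sqrt (INR (S i)) - sqrt (INR i)).
Proof.
  assert (H1 := one_le_INR_S i). assert (H0 := pos_INR i).
  set (x := sqrt (INR (S i))). set (y := sqrt (INR i)).
  assert (Hx : x * x = INR (S i)) by (apply sqrt_sqrt; lra).
  assert (Hy : y * y = INR i) by (apply sqrt_sqrt; lra).
  assert (0 <= y) by apply sqrt_pos.
  assert (Hx1 : 0 < x) by (apply sqrt_lt_R0; lra).
  rewrite <- Hx. replace (x / (x * x)) with (/ x) by (field; lra).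
  rewrite S_INR in Hx.
  apply Rmult_le_reg_l with x; [assumption|]. rewrite Rinv_r by lra. nra.
Qed.

(** A bound C sqrt n is stable under the recursion: a new exponent contributes at most the sum of C
    sqrt n / n, which telescopes to 2 C sqrt N. The constant doubles with each unit of depth. *)
Lemma chain_sum_le_sqrt rks : (forall k, In k rks -> (1 <= k)%nat) ->
  exists C, 0 <= C /\ forall N, chain_sum rks N <= C * sqrt (INR (S N)).
Proof.
  induction rks as [|k t IH]; intros Hk.
  - exists 1; split; [lra|intros N; cbn [chain_sum rev app length]].
    rewrite Rmult_1_l, <- sqrt_1; apply sqrt_le_1_alt, one_le_INR_S.
  - destruct IH as [C [HC IH]]; [intros; apply Hk; now right|].
    exists (C * 2); split; [lra|intros N; cbn [chain_sum rev app length]].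
    apply Rle_trans with (C * 2 * sqrt (INR N)).
    + apply Rle_trans with (bsum N (fun i => C * 2 * (sqrt (INR (S i)) - sqrt (INR i)))).
      * apply bsum_le; intros i _.
        eapply Rle_trans; [apply chain_term_le, Hk; now left|].
        rewrite Rmult_assoc.
        apply Rle_trans with (C * (sqrt (INR (S i)) / INR (S i))).
        -- unfold Rdiv; rewrite <- Rmult_assoc; apply Rmult_le_compat_r; [|apply IH].
           apply Rlt_le, Rinv_0_lt_compat. assert (H := one_le_INR_S i); lra.
        -- apply Rmult_le_compat_l; [assumption|apply inv_sqrt_le_diff].
      * rewrite bsum_scal, (bsum_telescope N (fun i => sqrt (INR i))).
        simpl INR at 2; rewrite sqrt_0; lra.
    + apply Rmult_le_compat_l; [lra|]. apply sqrt_le_1_alt, le_INR; lia.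
Qed.

(** Both g and u + g decrease to 0, so the alternating series of u is the difference of two Leibniz
    series. *)
Lemma ex_lim_alternating (u g : nat -> R) :
  is_lim_seq u 0 -> is_lim_seq g 0 ->
  (forall i, g (S i) <= g i) -> (forall i, u (S i) - u i <= g i - g (S i)) ->
  ex_finite_lim_seq (fun N => bsum N (fun i => (-1) ^ S i * u i)).
Proof.
  (* [tg_alt] starts with a positive sign and [sum_f_R0 _ N] has N + 1 terms, hence the minus sign
     and the shift. *)
  assert (E : forall f, sum_f_R0 (tg_alt f) = fun N => - bsum (S N) (fun i => (-1) ^ S i * f i)).
  { intros f; apply FunctionalExtensionality.functional_extensionality; intros N.
    induction N as [|N IH]; simpl; unfold tg_alt in *; [simpl; ring|].
    rewrite IH; simpl; ring. }
  assert (D : forall f, is_lim_seq f 0 -> (forall i, f (S i) <= f i) ->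
     ex_finite_lim_seq (fun N => bsum N (fun i => (-1) ^ S i * f i))).
  { intros f Hf Hd. destruct (alternated_series f) as [l Hl].
    - intros i; apply Hd.
    - now apply is_lim_seq_Reals.
    - exists (- l). apply is_lim_seq_incr_1.
      apply is_lim_seq_Reals in Hl; rewrite E in Hl.
      apply is_lim_seq_opp in Hl. simpl in Hl.
      eapply is_lim_seq_ext; [|exact Hl]. intros; simpl; ring. }
  intros Hu Hg Hd Hud.
  destruct (D (fun i => u i + g i)) as [l1 H1].
  - replace (Finite 0) with (Finite (0 + 0)) by (f_equal; ring). now apply is_lim_seq_plus'.
  - intros i; specialize (Hud i); lra.
  - destruct (D g Hg Hd) as [l2 H2]. exists (l1 - l2).
    eapply is_lim_seq_ext; [|exact (is_lim_seq_minus' _ _ _ _ H1 H2)].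
    intros N; simpl; rewrite <- bsum_minus; apply bsum_ext; intros; ring.
Qed.

Lemma is_lim_seq_inv_INR_S : is_lim_seq (fun i => / INR (S i)) 0.
Proof.
  replace (Finite 0) with (Rbar_inv p_infty) by reflexivity.
  apply is_lim_seq_inv; [|discriminate].
  apply (is_lim_seq_incr_1 INR), is_lim_seq_INR.
Qed.

Lemma is_lim_seq_inv_sqrt : is_lim_seq (fun i => / sqrt (INR (S i))) 0.
Proof.
  rewrite <- sqrt_0.
  apply is_lim_seq_ext with (fun i => sqrt (/ INR (S i))).
  - intros i; now rewrite sqrt_inv.
  - apply is_lim_seq_continuous; [|apply is_lim_seq_inv_INR_S].
    apply continuity_pt_sqrt; lra.
Qed.

Lemma is_lim_seq_0_squeeze (u g : nat -> R) :
  (forall i, Rabs (u i) <= g i) -> is_lim_seq g 0 -> is_lim_seq u 0.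
Proof.
  intros H Hg; apply (is_lim_seq_le_le (fun i => - g i) u g); [|
    replace (Finite 0) with (Rbar_opp 0) by (simpl; f_equal; ring);
    now apply -> is_lim_seq_opp|assumption].
  intros i; specialize (H i); apply Rabs_le_between in H; lra.
Qed.

Lemma is_lim_seq_scal_0 (c : R) (u : nat -> R) :
  is_lim_seq u 0 -> is_lim_seq (fun n => c * u n) 0.
Proof.
  intros H; replace (Finite 0) with (Rbar_mult c 0) by (simpl; f_equal; ring).
  now apply is_lim_seq_scal_l.
Qed.

Lemma is_lim_seq_plus_0 (u v : nat -> R) :
  is_lim_seq u 0 -> is_lim_seq v 0 -> is_lim_seq (fun n => u n + v n) 0.
Proof.
  intros Hu Hv; replace (Finite 0) with (Finite (0 + 0)) by (f_equal; ring).
  now apply is_lim_seq_plus'.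
Qed.

Lemma sqrt_div_self x : 0 < x -> sqrt x / x = / sqrt x.
Proof.
  intros H; rewrite <- (sqrt_sqrt x) at 2 by lra.
  assert (0 < sqrt x) by now apply sqrt_lt_R0.
  field; lra.
Qed.

(* The terms are nonnegative and, although not monotone, their increments are bounded by those
   of a decreasing null sequence. *)
Lemma Tbar_partial_cv ks k : (forall a, In a ks -> (1 <= a)%nat) -> (1 <= k)%nat ->
  ex_finite_lim_seq (Tbar_partial (ks ++ [k])).
Proof.
  intros Hks Hk.
  set (t := rev ks).
  assert (Ht : forall a, In a t -> (1 <= a)%nat) by (intros a Ha; apply Hks, in_rev, Ha).
  set (u := fun i => chain_sum t i / (2 * INR (S i) - INR (S (length t))) ^ k).
  set (c := 2 ^ S (length ks)).
  assert (Hlen : length t = length ks) by apply length_rev.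
  destruct (chain_sum_le_sqrt t Ht) as [C [HC Hbound]].
  (* The increment of the inner chain sum is its last term, of size at most C' sqrt n / n = C' /
     sqrt n. *)
  assert (Hinc : exists C', 0 <= C' /\ forall i,
     0 <= chain_sum t (S i) - chain_sum t i <= C' * / sqrt (INR (S i))).
  { destruct t as [|k' t'].
    - exists 0; split; [lra|]; intros i; simpl; lra.
    - destruct (chain_sum_le_sqrt t') as [C' [HC' Hb]]; [intros; apply Ht; now right|].
      exists C'; split; [assumption|intros i].
      assert (H1 := one_le_INR_S i).
      cbn [chain_sum]; rewrite bsum_S.
      match goal with |- context [bsum i ?f + ?e - _] => replace (bsum i f + e - bsum i f) with e by ring end.
      split.
      + destruct (le_lt_dec (length t') i) as [Hi|Hi].
        * apply Rle_mult_inv_pos; [apply chain_sum_nonneg|].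
          apply pow_lt. assert (H := index_le_odd_denominator i _ Hi); lra.
        * rewrite chain_sum_zero by assumption; unfold Rdiv; lra.
      + eapply Rle_trans; [apply chain_term_le, Ht; now left|].
        rewrite <- (sqrt_div_self (INR (S i))) by lra.
        unfold Rdiv; rewrite <- Rmult_assoc; apply Rmult_le_compat_r; [|apply Hb].
        apply Rlt_le, Rinv_0_lt_compat; lra. }
  destruct Hinc as [C' [HC' Hinc]].
  assert (Hlim : ex_finite_lim_seq (fun N => bsum N (fun i => (-1) ^ S i * u i))).
  { apply ex_lim_alternating with (g := fun i => 2 * C' * / sqrt (INR (S i))).
    - apply is_lim_seq_0_squeeze with (fun i => C * / sqrt (INR (S i)));
        [|apply is_lim_seq_scal_0, is_lim_seq_inv_sqrt].
      intros i. assert (H1 := one_le_INR_S i).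
      rewrite Rabs_pos_eq.
      + unfold u; eapply Rle_trans; [now apply chain_term_le|].
        rewrite <- (sqrt_div_self (INR (S i))) by lra.
        unfold Rdiv; rewrite <- Rmult_assoc; apply Rmult_le_compat_r; [|apply Hbound].
        apply Rlt_le, Rinv_0_lt_compat; lra.
      + unfold u; destruct (le_lt_dec (length t) i) as [Hi|Hi].
        * apply Rle_mult_inv_pos; [apply chain_sum_nonneg|].
          apply pow_lt. assert (H := index_le_odd_denominator i _ Hi); lra.
        * rewrite chain_sum_zero by assumption; unfold Rdiv; lra.
    - apply is_lim_seq_scal_0, is_lim_seq_inv_sqrt.
    - intros i; apply Rmult_le_compat_l; [lra|].
      apply Rinv_le_contravar; [apply sqrt_lt_R0; assert (H := one_le_INR_S i); lra|].
      apply sqrt_le_1_alt, le_INR; lia.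
    - intros i.
      set (x := sqrt (INR (S i))); set (y := sqrt (INR (S (S i)))).
      assert (H1 := one_le_INR_S i).
      assert (E2 : INR (S (S i)) = INR (S i) + 1) by apply S_INR.
      assert (Hx : x * x = INR (S i)) by (apply sqrt_sqrt; lra).
      assert (Hy : y * y = INR (S (S i))) by (apply sqrt_sqrt; lra).
      assert (Hx0 : 0 < x) by (apply sqrt_lt_R0; lra).
      assert (Hy0 : 0 < y) by (apply sqrt_lt_R0; lra).
      assert (Hxy : x <= y) by (apply sqrt_le_1_alt; lra).
      apply Rle_trans with (C' * / x * / INR (S (S i))).
      + specialize (Hinc i); fold x in Hinc. unfold u.
        destruct (le_lt_dec (length t) (S i)) as [Hi|Hi].
        2:{ rewrite !chain_sum_zero by lia. unfold Rdiv; rewrite !Rmult_0_l, Rminus_0_r.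
            apply Rmult_le_pos; [apply Rmult_le_pos; [assumption|]|];
              apply Rlt_le, Rinv_0_lt_compat; lra. }
        set (d' := 2 * INR (S (S i)) - INR (S (length t))).
        assert (Hd' := index_le_odd_denominator (S i) _ Hi); fold d' in Hd'.
        assert (He' := inv_pow_le_inv d' _ k Hd' ltac:(lra) Hk).
        (* The denominators increase, so using the later one, d', for both terms only enlarges the
           difference; it leaves the increment of the chain sum alone in the numerator. *)
        apply Rle_trans with ((chain_sum t (S i) - chain_sum t i) * / d' ^ k).
        * assert (H : chain_sum t i * / d' ^ k <=
             chain_sum t i / (2 * INR (S i) - INR (S (length t))) ^ k).
          { destruct (le_lt_dec (length t) i) as [Hi2|Hi2].
            - apply Rmult_le_compat_l; [apply chain_sum_nonneg|].
              assert (Hd := index_le_odd_denominator i _ Hi2).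
              apply Rinv_le_contravar; [apply pow_lt; lra|].
              apply pow_incr; unfold d'; lra.
            - rewrite chain_sum_zero by assumption; unfold Rdiv; lra. }
          unfold Rdiv in *; lra.
        * apply Rmult_le_compat; lra.
      + rewrite <- Hy. 
        replace (C' * / x * / (y * y)) with (C' * (/ x * / (y * y))) by ring.
        replace (2 * C' * / x - 2 * C' * / y) with (C' * (2 * (/ x - / y))) by ring.
        apply Rmult_le_compat_l; [assumption|].
        apply Rmult_le_reg_r with (x * (y * y)); [nra|].
        replace (/ x * / (y * y) * (x * (y * y))) with 1 by (field; lra).
        (* Here y^2 - x^2 = 1, so 1 = (y + x)(y - x) <= 2 y (y - x); this is the origin of the
           factor 2 in the dominating sequence 2 C' / sqrt n. *)
        replace (2 * (/ x - / y) * (x * (y * y))) with (2 * (y * (y - x))) by (field; lra).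
        nra. }
  destruct Hlim as [l Hl]; exists (c * l).
  apply is_lim_seq_ext with (fun N => c * bsum N (fun i => (-1) ^ S i * u i)).
  - intros N; rewrite Tbar_partial_snoc, <- bsum_scal.
    apply bsum_ext; intros i _. unfold u, c, t; rewrite length_rev; ring.
  - exact (is_lim_seq_scal_l _ c l Hl).
Qed.

(** [A] is the excess of the weight over the depth [S B]. [Tbar] is the real part of a [Lim_seq], so
    convergence must be known before it can be used as a limit; then finitely many limits are
    added. *)
Lemma is_lim_seq_W B A :
  is_lim_seq (fun N => bsum N (fun i => (-1) ^ S i * comp_term B A i)) (W (A + S B) (S B)).
Proof.
  eapply is_lim_seq_ext; [intros N; apply compositions_Tbar_partial|].
  unfold W; apply is_lim_seq_Rsum_list; intros ks Hks.
  apply in_compositions in Hks as [Hl [_ H]].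
  destruct ks as [|k ks _] using rev_ind; [discriminate|].
  destruct (Tbar_partial_cv ks k) as [l Hlim].
  - intros a Ha; apply H, in_or_app; now left.
  - apply H, in_or_app; right; now left.
  - replace (Tbar (ks ++ [k])) with l; [assumption|].
    unfold Tbar; destruct (ks ++ [k]) eqn:E; [now destruct ks|].
    rewrite <- E in *. now rewrite (is_lim_seq_unique _ _ Hlim).
Qed.

(** * The integral formula for [W] *)

Lemma exp_le x y : x <= y -> exp x <= exp y.
Proof. intros [H| ->]; [now apply Rlt_le, exp_increasing|apply Rle_refl]. Qed.

Lemma exp_mult_exp_opp w : exp w * exp (- w) = 1.
Proof. rewrite <- exp_plus, Rplus_opp_r, exp_0; reflexivity. Qed.

Lemma cosh_ge_1 w : 1 <= cosh w.
Proof.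
  unfold cosh; assert (H := exp_mult_exp_opp w).
  assert (H1 := exp_pos w); assert (H2 := exp_pos (- w)). 
  assert (0 <= (exp w - exp (- w)) ^ 2) by apply pow2_ge_0.
  nra.
Qed.

Lemma cosh_ge_half_exp w : exp w <= 2 * cosh w.
Proof. unfold cosh; assert (H := exp_pos (- w)); lra. Qed.

Lemma inv_cosh_pos w : 0 < / cosh w.
Proof. apply Rinv_0_lt_compat; assert (H := cosh_ge_1 w); lra. Qed.

Lemma inv_cosh_le_1 w : / cosh w <= 1.
Proof. rewrite <- Rinv_1; apply Rinv_le_contravar; [lra|apply cosh_ge_1]. Qed.

Lemma inv_cosh_le_exp w : / cosh w <= 2 * exp (- w).
Proof.
  assert (H := cosh_ge_half_exp w); assert (H1 := cosh_ge_1 w); assert (H2 := exp_pos w).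
  rewrite exp_Ropp.
  apply Rmult_le_reg_r with (cosh w * exp w); [nra|].
  replace (/ cosh w * (cosh w * exp w)) with (exp w) by (field; lra).
  replace (2 * / exp w * (cosh w * exp w)) with (2 * cosh w) by (field; lra).
  assumption.
Qed.

Lemma is_derive_inv_cosh w : is_derive (fun w => / cosh w) w (- sinh w / cosh w ^ 2).
Proof.
  assert (H := cosh_ge_1 w).
  apply (is_derive_inv cosh w (sinh w)); [|lra].
  apply is_derive_Reals, derivable_pt_lim_cosh.
Qed.

(** Divided powers: differentiation lowers the index without producing a factor. *)
Definition mono (a : nat) (x : R) : R := x ^ a / INR (fact a).

Lemma mono_0 x : mono 0 x = 1.
Proof. unfold mono; simpl; field. Qed.

Lemma mono_S_0 a : mono (S a) 0 = 0.
Proof. unfold mono; rewrite pow_ne_zero by lia; unfold Rdiv; ring. Qed.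

Lemma mono_nonneg a x : 0 <= x -> 0 <= mono a x.
Proof.
  intros H; apply Rle_mult_inv_pos; [now apply pow_le|apply INR_fact_lt_0].
Qed.

Lemma is_derive_mono_S a x : is_derive (mono (S a)) x (mono a x).
Proof.
  unfold mono. assert (H := INR_fact_lt_0 a).
  assert (H2 : INR (S a) <> 0) by (apply not_0_INR; lia).
  assert (E : INR (fact (S a)) = INR (S a) * INR (fact a)) by (rewrite fact_simpl; apply mult_INR).
  revert E; generalize (INR (fact (S a))); intros f E.
  auto_derive; [trivial|].
  change (match a with O => 1 | S _ => INR a + 1 end) with (INR (S a)).
  rewrite E; simpl Nat.pred; field; split; [lra|assumption].
Qed.

Lemma ex_derive_mono a x : ex_derive (mono a) x.
Proof.
  destruct a as [|a]; [|eexists; apply is_derive_mono_S].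
  apply ex_derive_ext with (fun _ => 1); [intros; now rewrite mono_0|apply ex_derive_const].
Qed.

Lemma nonneg_of_derive (f f' : R -> R) x : 0 <= x -> 0 <= f 0 ->
  (forall y, is_derive f y (f' y)) -> (forall y, 0 <= y -> 0 <= f' y) -> 0 <= f x.
Proof.
  intros Hx H0 Hd Hp; destruct (Req_dec x 0) as [->|Hx0]; [assumption|].
  destruct (MVT_cor2 f f' 0 x) as [c [Hc1 Hc2]]; [lra|intros; apply is_derive_Reals, Hd|].
  assert (0 <= f' c) by (apply Hp; lra). nra.
Qed.

Lemma mono_le_exp a x : 0 <= x -> mono a x <= exp x.
Proof.
  revert x; induction a as [|a IH]; intros x Hx.
  - rewrite mono_0; assert (H := exp_ineq1_le x); lra.
  - enough (0 <= exp x - mono (S a) x) by lra.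
    apply (nonneg_of_derive (fun y => exp y - mono (S a) y) (fun y => exp y - mono a y)).
    + assumption.
    + rewrite mono_S_0, exp_0; lra.
    + intros y; apply (is_derive_minus exp (mono (S a))); [apply is_derive_exp|apply is_derive_mono_S].
    + intros y Hy; specialize (IH y Hy); lra.
Qed.

(** The exponential bound is applied at x / 2. Only half of the growth of e^x is spent, so a factor
    e^(-x) still leaves an integrable e^(-x/2). *)
Lemma mono_le_exp_half a x : 0 <= x -> mono a x <= 2 ^ a * exp (x / 2).
Proof.
  intros Hx. assert (H := mono_le_exp a (x / 2) ltac:(lra)).
  replace (mono a x) with (2 ^ a * mono a (x / 2)).
  - apply Rmult_le_compat_l; [apply pow_le; lra|assumption].
  - unfold mono, Rdiv. rewrite Rpow_mult_distr, pow_inv. field.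
    split; [apply INR_fact_neq_0|apply pow_nonzero; lra].
Qed.

(** The bound does not depend on T, which is how tails are controlled without improper integrals. *)
Lemma RInt_abs_le_exp (f : R -> R) K lam T : 0 <= K -> 0 < lam -> 0 <= T ->
  (forall x, continuous f x) ->
  (forall x, 0 <= x <= T -> Rabs (f x) <= K * exp (- lam * x)) ->
  Rabs (RInt f 0 T) <= K / lam.
Proof.
  intros HK Hl HT Hc Hb.
  assert (Hex : ex_RInt f 0 T) by (apply (@ex_RInt_continuous R_CompleteNormedModule); intros; apply Hc).
  assert (HI : is_RInt (fun x => K * exp (- lam * x)) 0 T (K / lam * (1 - exp (- lam * T)))).
  { replace (K / lam * (1 - exp (- lam * T))) with
      (minus (- K / lam * exp (- lam * T)) (- K / lam * exp (- lam * 0))).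
    - apply (is_RInt_derive (fun x => - K / lam * exp (- lam * x))).
      + intros x _; auto_derive; [trivial|field; lra].
      + intros x _; apply (ex_derive_continuous (fun x => K * exp (- lam * x))); now auto_derive.
    - unfold minus, plus, opp; simpl. rewrite Rmult_0_r, exp_0; field; lra. }
  apply Rle_trans with (RInt (fun x => K * exp (- lam * x)) 0 T).
  - eapply Rle_trans; [apply abs_RInt_le; assumption|].
    apply RInt_le; [assumption| |eexists; exact HI|intros; apply Hb; lra].
    apply (@ex_RInt_continuous R_CompleteNormedModule); intros; apply continuous_comp; [apply Hc|apply continuous_Rabs].
  - rewrite (is_RInt_unique _ _ _ _ HI).
    assert (0 <= K / lam) by (apply Rle_mult_inv_pos; assumption).
    assert (H1 := exp_pos (- lam * T)). nra.
Qed.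

(** * Sums over compositions and their generating polynomials in w *)

Lemma comp_sum_nonneg B A N : 0 <= comp_sum B A N.
Proof.
  rewrite <- compositions_chain_sum.
  induction (compositions B (A + B)) as [|ks l IH]; unfold Rsum_list in *; simpl; [lra|].
  apply Rplus_le_le_0_compat; [|assumption].
  apply Rmult_le_pos; [apply pow_le; lra|apply chain_sum_nonneg].
Qed.

Lemma comp_sum_zero B A N : (N < B)%nat -> comp_sum B A N = 0.
Proof.
  intros H; rewrite <- compositions_chain_sum.
  rewrite (Rsum_list_ext _ (fun _ => 0 * 0)), Rsum_list_scal; [ring|].
  intros ks Hks; apply in_compositions in Hks as [Hl _].
  rewrite chain_sum_zero by (rewrite length_rev; lia); ring.
Qed.

Lemma comp_sum_le_sqrt B A : exists C, 0 <= C /\ forall N, comp_sum B A N <= C * sqrt (INR (S N)).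
Proof.
  assert (H : forall ks, In ks (compositions B (A + B)) -> forall a, In a ks -> (1 <= a)%nat)
    by (intros ks Hks; now apply in_compositions in Hks as [_ [_ H]]).
  enough (G : exists C, 0 <= C /\ forall N,
     Rsum_list (map (fun ks => 2 ^ B * chain_sum (rev ks) N) (compositions B (A + B)))
       <= C * sqrt (INR (S N))).
  { destruct G as [C [HC G]]; exists C; split; [assumption|].
    intros N; rewrite <- compositions_chain_sum; apply G. }
  induction (compositions B (A + B)) as [|ks l IH]; unfold Rsum_list; simpl map; simpl fold_right.
  - exists 0; split; [lra|intros; lra].
  - destruct IH as [C [HC IH]]; [intros ks' Hks'; apply H; now right|].
    destruct (chain_sum_le_sqrt (rev ks)) as [C' [HC' Hks]];
      [intros a Ha; apply (H ks); [now left|now apply in_rev]|].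
    assert (H2 : 0 < 2 ^ B) by (apply pow_lt; lra).
    exists (2 ^ B * C' + C); split; [nra|].
    intros N; specialize (IH N); specialize (Hks N); unfold Rsum_list in IH. nra.
Qed.

Lemma comp_term_nonneg B A i : 0 <= comp_term B A i.
Proof.
  unfold comp_term; apply bsum_nonneg; intros a _.
  destruct (le_lt_dec B i) as [Hi|Hi].
  - apply Rle_mult_inv_pos; [assert (H := comp_sum_nonneg B (A - a) i); lra|].
    apply pow_lt; assert (H := index_le_odd_denominator i B Hi); lra.
  - rewrite comp_sum_zero by assumption; unfold Rdiv; lra.
Qed.

Lemma comp_term_zero B A i : (i < B)%nat -> comp_term B A i = 0.
Proof.
  intros H; unfold comp_term; apply bsum_zero; intros a _; rewrite comp_sum_zero by assumption; unfold Rdiv; ring.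
Qed.

Lemma odd_denominator_nonzero B i : (B <= i)%nat -> 2 * INR (S i) - INR (S B) <> 0.
Proof. intros H; assert (H1 := index_le_odd_denominator i B H); lra. Qed.

Lemma comp_term_rec_0 B i : (2 * INR (S i) - INR (S B)) * comp_term B 0 i = 2 * comp_sum B 0 i.
Proof.
  destruct (le_lt_dec B i) as [Hi|Hi].
  - unfold comp_term; rewrite bsum_S; simpl bsum. simpl Nat.sub.
    apply odd_denominator_nonzero in Hi. rewrite pow_1; field; assumption.
  - rewrite comp_term_zero, comp_sum_zero by assumption; ring.
Qed.

(** Multiplying by the denominator lowers every exponent by one: the exponent 1 gives the separate
    [comp_sum], the others reproduce [comp_term B A]. Below the depth all terms vanish. *)
Lemma comp_term_rec_S B A i :
  (2 * INR (S i) - INR (S B)) * comp_term B (S A) i = comp_term B A i + 2 * comp_sum B (S A) i.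
Proof.
  destruct (le_lt_dec B i) as [Hi|Hi].
  - apply odd_denominator_nonzero in Hi.
    unfold comp_term; rewrite (bsum_S_l (S A)), Rmult_plus_distr_l, <- bsum_scal, Rplus_comm.
    f_equal.
    + apply bsum_ext; intros a Ha. rewrite Nat.sub_succ.
      set (d := 2 * INR (S i) - INR (S B)) in *.
      rewrite <- (tech_pow_Rmult d (S a)). field. split; [now apply pow_nonzero|assumption].
    + rewrite pow_1, Nat.sub_0_r; field; assumption.
  - rewrite !comp_term_zero, comp_sum_zero by assumption; ring.
Qed.

(** The excess weight [A] is shared between the chain sum and a divided power of w. *)
Definition comp_poly (B A i : nat) (w : R) : R := bsum (S A) (fun a => comp_sum B (A - a) i * mono a w).
Definition comp_term_poly (B A i : nat) (w : R) : R := bsum (S A) (fun a => comp_term B (A - a) i * mono a w).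

Lemma comp_poly_S B A i w : comp_poly (S B) A (S i) w - comp_poly (S B) A i w = comp_term_poly B A i w.
Proof.
  unfold comp_poly, comp_term_poly; rewrite <- bsum_minus; apply bsum_ext; intros a _.
  rewrite !comp_sum_S, bsum_S; ring.
Qed.

Lemma comp_poly_S_0 B A w : comp_poly (S B) A 0 w = 0.
Proof. unfold comp_poly; apply bsum_zero; intros a _; rewrite comp_sum_S; simpl; ring. Qed.

Lemma comp_poly_0 A i w : comp_poly 0 A i w = mono A w.
Proof.
  unfold comp_poly; rewrite bsum_S, bsum_zero.
  - rewrite Nat.sub_diag; simpl comp_sum; ring.
  - intros a Ha; simpl comp_sum. destruct (Nat.eqb_spec (A - a) 0); [lia|ring].
Qed.

Lemma comp_poly_nonneg B A i w : 0 <= w -> 0 <= comp_poly B A i w.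
Proof.
  intros H; apply bsum_nonneg; intros a _.
  apply Rmult_le_pos; [apply comp_sum_nonneg|now apply mono_nonneg].
Qed.

Lemma comp_poly_le B A : exists C, 0 <= C /\ forall i w, 0 <= w ->
  comp_poly B A i w <= C * sqrt (INR (S i)) * exp (w / 2).
Proof.
  (* Only the number of summands is generalized; the [A] inside [comp_sum B (A - a)] stays fixed
     during the induction. *)
  unfold comp_poly. generalize (S A) as n.
  induction n as [|n [C [HC IH]]].
  - exists 0; split; [lra|]. intros; simpl bsum; lra.
  - destruct (comp_sum_le_sqrt B (A - n)) as [C' [HC' HX]].
    assert (H2 : 0 < 2 ^ n) by (apply pow_lt; lra).
    exists (C + C' * 2 ^ n); split; [nra|].
    intros i w Hw; rewrite bsum_S.
    replace ((C + C' * 2 ^ n) * sqrt (INR (S i)) * exp (w / 2)) with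
      (C * sqrt (INR (S i)) * exp (w / 2) + (C' * sqrt (INR (S i))) * (2 ^ n * exp (w / 2))) by ring.
    apply Rplus_le_compat; [now apply IH|].
    apply Rmult_le_compat; [apply comp_sum_nonneg|now apply mono_nonneg|apply HX|now apply mono_le_exp_half].
Qed.

(* With [L_B,A(w)] the truncated alternating series of [W (A + B) B] with [e^(-(2 n_B - B) w)] inserted,
   this is the sum over [a <= A] of [L_B,(A-a)(w) w^a / a!].  The combination is chosen so that its
   derivative only involves depth [B - 1], up to the truncation error [alt_tail]. *)
Definition alt_chain (N B A : nat) (w : R) : R :=
  exp (INR B * w) * comp_poly B A 0 w +
  bsum N (fun i => (-1) ^ S i * exp (- (2 * INR (S i) - INR B) * w) *
                   (comp_poly B A (S i) w - comp_poly B A i w)).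

(** At depth 0 only the boundary term survives, while at positive depth it is the boundary term that
    vanishes. Keeping it allows a single derivative formula for all depths. *)
Lemma alt_chain_0 N A w : alt_chain N 0 A w = mono A w.
Proof.
  unfold alt_chain; rewrite bsum_zero.
  - rewrite comp_poly_0; simpl INR; rewrite Rmult_0_l, exp_0; ring.
  - intros i _; rewrite !comp_poly_0; ring.
Qed.

Lemma alt_chain_S N B A w : alt_chain N (S B) A w =
  bsum N (fun i => (-1) ^ S i * (exp (- (2 * INR (S i) - INR (S B)) * w) * comp_term_poly B A i w)).
Proof.
  unfold alt_chain; rewrite comp_poly_S_0, Rmult_0_r, Rplus_0_l; apply bsum_ext; intros i _.
  rewrite comp_poly_S; ring.
Qed.

Lemma alt_chain_S_at_0 N B A : alt_chain N (S B) A 0 = bsum N (fun i => (-1) ^ S i * comp_term B A i).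
Proof.
  rewrite alt_chain_S; apply bsum_ext; intros i _; f_equal.
  rewrite Rmult_0_r, exp_0, Rmult_1_l; unfold comp_term_poly.
  rewrite bsum_S_l, Nat.sub_0_r, mono_0, bsum_zero; [ring|].
  intros a _; rewrite mono_S_0; ring.
Qed.

Lemma is_derive_comp_term_poly B A i w : is_derive (comp_term_poly B A i) w
  (bsum A (fun a => comp_term B (A - S a) i * mono a w)).
Proof.
  apply is_derive_ext with (fun w => comp_term B A i + bsum A (fun a => comp_term B (A - S a) i * mono (S a) w)).
  - intros t; unfold comp_term_poly; rewrite bsum_S_l, mono_0, Nat.sub_0_r. now rewrite Rmult_1_r.
  - replace (bsum A (fun a => comp_term B (A - S a) i * mono a w)) with
      (plus 0 (bsum A (fun a => comp_term B (A - S a) i * mono a w))) by apply Rplus_0_l.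
    apply (is_derive_plus (fun _ => comp_term B A i)
       (fun w => bsum A (fun a => comp_term B (A - S a) i * mono (S a) w))).
    + apply (is_derive_const (comp_term B A i)).
    + apply (is_derive_bsum A (fun a w => comp_term B (A - S a) i * mono (S a) w)).
      intros a _; apply (is_derive_scal (mono (S a))), is_derive_mono_S.
Qed.

(** Writing d for the denominator and P for [comp_term_poly B A i], the derivative is e^(-d w) (P' -
    d P), and the recursions of [comp_term] give d P = P' + 2 [comp_poly B A i]. The outermost
    exponent thus disappears, and only depth B is left. *)
Lemma is_derive_exp_comp_term_poly B A i w :
  is_derive (fun w => exp (- (2 * INR (S i) - INR (S B)) * w) * comp_term_poly B A i w) w
    (- (exp (- (2 * INR (S i) - INR (S B)) * w) * (2 * comp_poly B A i w))).
Proof.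
  set (d := 2 * INR (S i) - INR (S B)).
  evar_last.
  - apply (is_derive_mult (fun w => exp (- d * w)) (comp_term_poly B A i) w (- d * exp (- d * w))).
    + auto_derive; [trivial|ring].
    + apply is_derive_comp_term_poly.
    + exact Rmult_comm.
  - unfold plus, mult; simpl.
    assert (E : d * comp_term_poly B A i w =
       bsum A (fun a => comp_term B (A - S a) i * mono a w) + 2 * comp_poly B A i w).
    { unfold comp_term_poly, comp_poly. rewrite <- !bsum_scal, !bsum_S.
      rewrite (bsum_ext A (fun a => d * (comp_term B (A - a) i * mono a w))
        (fun a => comp_term B (A - S a) i * mono a w + 2 * (comp_sum B (A - a) i * mono a w))).
      - rewrite bsum_plus, Nat.sub_diag, <- (Rmult_assoc d), <- (Rmult_assoc 2). unfold d; rewrite comp_term_rec_0; ring.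
      - intros a Ha. rewrite <- Rmult_assoc. unfold d.
        replace (A - a)%nat with (S (A - S a)) by lia. rewrite comp_term_rec_S; ring. }
    transitivity (exp (- d * w) * (bsum A (fun a => comp_term B (A - S a) i * mono a w) - d * comp_term_poly B A i w));
      [ring|rewrite E; ring].
Qed.

(** Summation by parts: 2 cosh w e^(-d w) is the sum of the exponentials with exponents d - 1 and d
    + 1. Neighbouring terms share an exponential with opposite signs, which leaves differences of x
    and the two end terms. *)
Lemma alternating_geometric_abel N B w (x : nat -> R) :
  cosh w * bsum N (fun i => (-1) ^ i * exp (- (2 * INR (S i) - INR (S B)) * w) * (2 * x i)) =
  exp (INR B * w) * x O +
  bsum N (fun i => (-1) ^ S i * exp (- (2 * INR (S i) - INR B) * w) * (x (S i) - x i)) -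
  (-1) ^ N * exp (- (2 * INR N - INR B) * w) * x N.
Proof.
  induction N as [|N IH].
  - cbn [bsum pow]; simpl (INR 0).
    replace (- (2 * 0 - INR B) * w) with (INR B * w) by ring. ring.
  - rewrite !bsum_S, Rmult_plus_distr_l, IH, !S_INR, <- !tech_pow_Rmult.
    set (e := exp (- (2 * (INR N + 1) - (INR B + 1)) * w)).
    assert (E : 2 * cosh w * e = exp (- (2 * INR N - INR B) * w) +
                exp (- (2 * (INR N + 1) - INR B) * w)).
    { unfold cosh, e.
      replace (- (2 * INR N - INR B) * w) with (w + - (2 * (INR N + 1) - (INR B + 1)) * w) by ring.
      replace (- (2 * (INR N + 1) - INR B) * w) with (- w + - (2 * (INR N + 1) - (INR B + 1)) * w) by ring.
      rewrite !exp_plus; field. }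
    transitivity (exp (INR B * w) * x O +
      bsum N (fun i => (-1) ^ S i * exp (- (2 * INR (S i) - INR B) * w) * (x (S i) - x i)) -
      (-1) ^ N * exp (- (2 * INR N - INR B) * w) * x N + (-1) ^ N * x N * (2 * cosh w * e)); [ring|].
    rewrite E; ring.
Qed.

Definition alt_tail (N B A : nat) (w : R) : R :=
  (-1) ^ N * exp (- (2 * INR N - INR B) * w) * comp_poly B A N w.

(** The differentiated terms form an alternating exponential sum over depth B, and summation by
    parts identifies cosh w times it with [alt_chain N B A]; the upper end term of that summation is
    [alt_tail]. *)
Lemma is_derive_alt_chain N B A w :
  is_derive (alt_chain N (S B) A) w (/ cosh w * (alt_chain N B A w - alt_tail N B A w)).
Proof.
  apply is_derive_ext with (fun w => bsum N (fun i => (-1) ^ S i *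
     (exp (- (2 * INR (S i) - INR (S B)) * w) * comp_term_poly B A i w))); [intros; symmetry; apply alt_chain_S|].
  evar_last.
  - apply (is_derive_bsum N (fun i w => (-1) ^ S i *
     (exp (- (2 * INR (S i) - INR (S B)) * w) * comp_term_poly B A i w))).
    intros i _; apply (is_derive_scal (fun w => exp (- (2 * INR (S i) - INR (S B)) * w) * comp_term_poly B A i w)),
      is_derive_exp_comp_term_poly.
  - unfold alt_chain, alt_tail. rewrite <- (alternating_geometric_abel N B w (fun i => comp_poly B A i w)).
    rewrite <- Rmult_assoc, Rinv_l, Rmult_1_l by (assert (H := cosh_ge_1 w); lra).
    apply bsum_ext; intros i _. rewrite <- tech_pow_Rmult; ring.
Qed.

Lemma ex_derive_alt_chain N B A w : ex_derive (alt_chain N B A) w.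
Proof.
  destruct B as [|B]; [|eexists; apply is_derive_alt_chain].
  apply ex_derive_ext with (mono A); [intros; now rewrite alt_chain_0|apply ex_derive_mono].
Qed.

Lemma ex_derive_comp_poly B A N w : ex_derive (comp_poly B A N) w.
Proof.
  unfold comp_poly; generalize (S A); induction n as [|n IH]; simpl; [apply ex_derive_const|].
  apply (ex_derive_plus (fun w => bsum n (fun a => comp_sum B (A - a) N * mono a w))); [assumption|].
  apply (ex_derive_scal (mono n)), ex_derive_mono.
Qed.

Lemma ex_derive_alt_tail N B A w : ex_derive (alt_tail N B A) w.
Proof.
  apply (ex_derive_mult (fun w => (-1) ^ N * exp (- (2 * INR N - INR B) * w)));
    [auto_derive; trivial|apply ex_derive_comp_poly].
Qed.

(** Every exponent 2 n - (B + 1) of a nonzero term is at least 1, so e^(-w) factors out of the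
    absolute values; what remains telescopes. *)
Lemma alt_chain_S_le N B A w : 0 <= w -> Rabs (alt_chain N (S B) A w) <= exp (- w) * comp_poly (S B) A N w.
Proof.
  intros Hw; rewrite alt_chain_S.
  eapply Rle_trans; [apply bsum_Rabs|].
  apply Rle_trans with (bsum N (fun i => exp (- w) * (comp_poly (S B) A (S i) w - comp_poly (S B) A i w))).
  - apply bsum_le; intros i _. rewrite comp_poly_S.
    assert (HY : 0 <= comp_term_poly B A i w) by (apply bsum_nonneg; intros a _;
      apply Rmult_le_pos; [apply comp_term_nonneg|now apply mono_nonneg]).
    rewrite !Rabs_mult, pow_1_abs, Rmult_1_l, (Rabs_pos_eq (exp _)), (Rabs_pos_eq (comp_term_poly _ _ _ _))
      by (try assumption; apply Rlt_le, exp_pos).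
    destruct (le_lt_dec B i) as [Hi|Hi].
    + apply Rmult_le_compat_r; [assumption|].
      assert (H := index_le_odd_denominator i B Hi); assert (H1 := one_le_INR_S i).
      apply exp_le. nra.
    + replace (comp_term_poly B A i w) with 0; [lra|].
      symmetry; apply bsum_zero; intros a _; rewrite comp_term_zero by assumption; ring.
  - rewrite bsum_scal, (bsum_telescope N (fun i => comp_poly (S B) A i w)), comp_poly_S_0; lra.
Qed.

(** * The Gudermannian function *)

Definition gd (w : R) : R := PI / 2 - 2 * atan (exp (- w)).

Lemma is_derive_gd w : is_derive gd w (/ cosh w).
Proof.
  unfold gd; evar_last.
  - apply (is_derive_minus (fun _ => PI / 2) (fun w => 2 * atan (exp (- w))) w 0).
    + apply (is_derive_const (PI / 2)).
    + apply (is_derive_scal (fun w => atan (exp (- w)))).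
      apply (is_derive_comp atan (fun w => exp (- w)) w (/ (1 + (exp (- w))²)) (- exp (- w))).
      * apply is_derive_atan.
      * auto_derive; [trivial|ring].
  - unfold minus, plus, opp, scal; simpl; unfold mult; simpl; unfold cosh, Rsqr.
    assert (H := exp_mult_exp_opp w); assert (H1 := exp_pos w); assert (H2 := exp_pos (- w)).
    assert (E : exp w = / exp (- w)) by (rewrite exp_Ropp, Rinv_inv; reflexivity).
    rewrite E; field; split; nra.
Qed.

Lemma gd_0 : gd 0 = 0.
Proof. unfold gd; rewrite Ropp_0, exp_0, atan_1; field. Qed.

Lemma gd_bounds w : 0 <= w -> 0 <= gd w <= PI / 2.
Proof.
  intros Hw; split.
  - apply (nonneg_of_derive gd (fun w => / cosh w)); [assumption|rewrite gd_0; lra|apply is_derive_gd|].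
    intros y _; apply Rlt_le, inv_cosh_pos.
  - unfold gd; enough (0 <= atan (exp (- w))) by lra.
    rewrite <- atan_0; apply Rlt_le, atan_increasing, exp_pos.
Qed.

Lemma ex_derive_mono_gd b w : ex_derive (fun w => mono b (gd w)) w.
Proof.
  apply (ex_derive_comp (mono b) gd); [apply ex_derive_mono|eexists; apply is_derive_gd].
Qed.

Lemma is_derive_mono_gd b w :
  is_derive (fun w => mono (S b) (gd w)) w (mono b (gd w) * / cosh w).
Proof.
  evar_last.
  - apply (is_derive_comp (mono (S b)) gd w); [apply is_derive_mono_S|apply is_derive_gd].
  - unfold scal; simpl; unfold mult; simpl; ring.
Qed.

Lemma mono_incr a x y : 0 <= x <= y -> mono a x <= mono a y.
Proof.
  intros H; apply Rmult_le_compat_r; [|now apply pow_incr].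
  apply Rlt_le, Rinv_0_lt_compat, INR_fact_lt_0.
Qed.

Lemma ex_RInt_of_ex_derive (f : R -> R) a b : (forall x, ex_derive f x) -> ex_RInt f a b.
Proof.
  intros H; apply (@ex_RInt_continuous R_CompleteNormedModule); intros x _.
  apply (ex_derive_continuous f), H.
Qed.

(** From e^(N/2) >= 1 + N/2 >= (N + 1)/2. It disposes of the boundary term at w = N. *)
Lemma sqrt_INR_exp_le N : sqrt (INR (S N)) * exp (- INR N / 2) <= 2 * / sqrt (INR (S N)).
Proof.
  assert (H1 := one_le_INR_S N).
  assert (Hs : 0 < sqrt (INR (S N))) by (apply sqrt_lt_R0; lra).
  assert (Hs2 : sqrt (INR (S N)) * sqrt (INR (S N)) = INR (S N)) by (apply sqrt_sqrt; lra).
  assert (He := exp_ineq1_le (INR N / 2)).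
  replace (- INR N / 2) with (- (INR N / 2)) by field. rewrite exp_Ropp.
  assert (0 < exp (INR N / 2)) by apply exp_pos.
  apply Rmult_le_reg_r with (exp (INR N / 2) * sqrt (INR (S N))); [nra|].
  replace (sqrt (INR (S N)) * / exp (INR N / 2) * (exp (INR N / 2) * sqrt (INR (S N))))
    with (sqrt (INR (S N)) * sqrt (INR (S N))) by (field; lra).
  replace (2 * / sqrt (INR (S N)) * (exp (INR N / 2) * sqrt (INR (S N)))) with (2 * exp (INR N / 2))
    by (field; lra).
  rewrite Hs2, S_INR; assert (H2 := pos_INR N); lra.
Qed.

(** * Integration by parts against functions of v *)

Section ByParts.

Variables phi psi : R -> R.
Hypothesis Hphi : forall w, is_derive phi w (psi w * / cosh w).
Hypothesis Hpsi : forall w, ex_derive psi w.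
Variable c : R.
Hypothesis Hc : forall w, 0 <= w -> Rabs (phi w) <= c.

(** Integrates the derivative of [phi] times [alt_chain N (S B) A]. It is used with [phi] a divided
    power of v, to lower the depth, and with [phi] = 1 and [psi] = 0, to reach the value at w =
    0. *)
Lemma alt_chain_by_parts N B A :
  RInt (fun w => psi w * / cosh w * alt_chain N (S B) A w) 0 (INR N) +
  RInt (fun w => phi w * / cosh w * alt_chain N B A w) 0 (INR N) + phi 0 * alt_chain N (S B) A 0 =
  phi (INR N) * alt_chain N (S B) A (INR N) + RInt (fun w => phi w * / cosh w * alt_tail N B A w) 0 (INR N).
Proof.
  set (f1 := fun w => psi w * / cosh w * alt_chain N (S B) A w).
  set (f2 := fun w => phi w * / cosh w * alt_chain N B A w).
  set (f3 := fun w => phi w * / cosh w * alt_tail N B A w).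
  assert (Dphi : forall w, ex_derive phi w) by (intros w; eexists; apply Hphi).
  assert (Dcosh : forall w, ex_derive (fun w => / cosh w) w) by (intros w; eexists; apply is_derive_inv_cosh).
  assert (D1 : forall w, ex_derive f1 w).
  { intros w; apply (ex_derive_mult (fun w => psi w * / cosh w)); [|apply ex_derive_alt_chain].
    apply (ex_derive_mult psi); auto. }
  assert (D2 : forall w, ex_derive f2 w).
  { intros w; apply (ex_derive_mult (fun w => phi w * / cosh w)); [|apply ex_derive_alt_chain].
    apply (ex_derive_mult phi); auto. }
  assert (D3 : forall w, ex_derive f3 w).
  { intros w; apply (ex_derive_mult (fun w => phi w * / cosh w)); [|apply ex_derive_alt_tail].
    apply (ex_derive_mult phi); auto. }
  assert (H : is_RInt (fun w => f1 w + f2 w - f3 w) 0 (INR N)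
     (minus (phi (INR N) * alt_chain N (S B) A (INR N)) (phi 0 * alt_chain N (S B) A 0))).
  { apply (is_RInt_derive (fun w => phi w * alt_chain N (S B) A w)).
    - intros w _; evar_last.
      + apply (is_derive_mult phi (alt_chain N (S B) A)); [apply Hphi|apply is_derive_alt_chain|exact Rmult_comm].
      + unfold plus, mult, f1, f2, f3; simpl; ring.
    - intros w _; apply (ex_derive_continuous (fun w => f1 w + f2 w - f3 w)).
      apply (ex_derive_minus (fun w => f1 w + f2 w)); [apply (ex_derive_plus f1 f2)|]; auto. }
  apply (@is_RInt_unique R_CompleteNormedModule) in H.
  rewrite (RInt_minus (fun w => f1 w + f2 w)) in H.
  - rewrite (RInt_plus f1 f2) in H by (apply ex_RInt_of_ex_derive; assumption).
    unfold minus, plus, opp in H; simpl in H. lra.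
  - apply ex_RInt_of_ex_derive; intros; apply (ex_derive_plus f1 f2); auto.
  - now apply ex_RInt_of_ex_derive.
Qed.

Lemma alt_chain_by_parts_lim B A : is_lim_seq (fun N =>
  RInt (fun w => psi w * / cosh w * alt_chain N (S B) A w) 0 (INR N) +
  RInt (fun w => phi w * / cosh w * alt_chain N B A w) 0 (INR N) + phi 0 * alt_chain N (S B) A 0) 0.
Proof.
  assert (Hc0 : 0 <= c) by (eapply Rle_trans; [apply Rabs_pos|apply (Hc 0); lra]).
  apply is_lim_seq_ext with (fun N => phi (INR N) * alt_chain N (S B) A (INR N) +
    RInt (fun w => phi w * / cosh w * alt_tail N B A w) 0 (INR N)); [intros; symmetry; apply alt_chain_by_parts|].
  apply is_lim_seq_plus_0.
  - destruct (comp_poly_le (S B) A) as [C [HC HX]].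
    apply is_lim_seq_0_squeeze with (fun N => c * C * 2 * / sqrt (INR (S N)));
      [|apply is_lim_seq_scal_0, is_lim_seq_inv_sqrt].
    intros N. assert (HN := pos_INR N). rewrite Rabs_mult, !(Rmult_assoc c).
    apply Rmult_le_compat; [apply Rabs_pos|apply Rabs_pos|now apply Hc|].
    eapply Rle_trans; [now apply alt_chain_S_le|].
    apply Rle_trans with (C * (sqrt (INR (S N)) * exp (- INR N / 2))).
    + apply Rle_trans with (exp (- INR N) * (C * sqrt (INR (S N)) * exp (INR N / 2))).
      * apply Rmult_le_compat_l; [apply Rlt_le, exp_pos|now apply HX].
      * right. replace (- INR N / 2) with (- INR N + INR N / 2) by field. rewrite exp_plus; ring.
    + rewrite (Rmult_assoc C 2); apply Rmult_le_compat_l; [assumption|apply sqrt_INR_exp_le].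
  - destruct (comp_poly_le B A) as [C [HC HX]].
    (* For N >= B + 1 the decay rate 2 N - B, reduced by the 1/2 spent on [comp_poly], is still at
       least N. *)
    apply is_lim_seq_incr_n with (S B).
    apply is_lim_seq_0_squeeze with (fun n => c * C * 2 * / sqrt (INR (S (n + S B)))).
    2:{ apply (is_lim_seq_incr_n (fun N => c * C * 2 * / sqrt (INR (S N)))).
        apply is_lim_seq_scal_0, is_lim_seq_inv_sqrt. }
    intros n; set (N := (n + S B)%nat).
    assert (HB : INR B + 1 <= INR N) by (rewrite <- S_INR; apply le_INR; lia).
    assert (HB0 := pos_INR B).
    assert (Hs : 0 < sqrt (INR (S N))) by (apply sqrt_lt_R0; rewrite S_INR; lra).
    assert (Hs2 : sqrt (INR (S N)) * sqrt (INR (S N)) = INR (S N)) by (apply sqrt_sqrt; rewrite S_INR; lra).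
    (* Integrating e^(-N x) yields the factor 1/N that beats the growth sqrt N of the chain sums. *)
    apply Rle_trans with (c * C * sqrt (INR (S N)) / INR N).
    + apply RInt_abs_le_exp; [|lra|lra| |].
      * apply Rmult_le_pos; [nra|lra].
      * intros x; apply (ex_derive_continuous (fun w => phi w * / cosh w * alt_tail N B A w)).
        apply (ex_derive_mult (fun w => phi w * / cosh w)); [|apply ex_derive_alt_tail].
        apply (ex_derive_mult phi); eexists; [apply Hphi|apply is_derive_inv_cosh].
      * intros x [Hx _]. unfold alt_tail.
        rewrite !Rabs_mult, pow_1_abs, Rmult_1_l.
        rewrite (Rabs_pos_eq (/ cosh x)) by apply Rlt_le, inv_cosh_pos.
        rewrite (Rabs_pos_eq (exp _)) by apply Rlt_le, exp_pos.
        rewrite (Rabs_pos_eq (comp_poly _ _ _ _)) by now apply comp_poly_nonneg.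
        replace (c * C * sqrt (INR (S N)) * exp (- INR N * x)) with
          (c * 1 * (C * sqrt (INR (S N)) * exp (- INR N * x))) by ring.
        assert (HP := inv_cosh_pos x).
        assert (HXW := comp_poly_nonneg B A N x Hx).
        apply Rmult_le_compat.
        -- apply Rmult_le_pos; [apply Rabs_pos|lra].
        -- apply Rmult_le_pos; [apply Rlt_le, exp_pos|assumption].
        -- apply Rmult_le_compat; [apply Rabs_pos|lra|now apply Hc|apply inv_cosh_le_1].
        -- apply Rle_trans with (exp (- (2 * INR N - INR B) * x) * (C * sqrt (INR (S N)) * exp (x / 2))).
           ++ apply Rmult_le_compat_l; [apply Rlt_le, exp_pos|now apply HX].
           ++ replace (exp (- (2 * INR N - INR B) * x) * (C * sqrt (INR (S N)) * exp (x / 2))) with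
                (C * sqrt (INR (S N)) * exp (- (2 * INR N - INR B) * x + x / 2)) by (rewrite exp_plus; ring).
              apply Rmult_le_compat_l; [nra|]. apply exp_le. nra.
    + unfold Rdiv; rewrite !(Rmult_assoc (c * C)).
      apply Rmult_le_compat_l; [nra|].
      apply Rmult_le_reg_r with (INR N * sqrt (INR (S N))); [nra|].
      replace (sqrt (INR (S N)) * / INR N * (INR N * sqrt (INR (S N)))) with
        (sqrt (INR (S N)) * sqrt (INR (S N))) by (field; lra).
      replace (2 * / sqrt (INR (S N)) * (INR N * sqrt (INR (S N)))) with (2 * INR N) by (field; lra).
      rewrite Hs2, S_INR; lra.
Qed.

End ByParts.

(** Each integration by parts removes one unit of depth, raises the power of v by one and changes
    the sign; the boundary term at w = 0 vanishes because gd 0 = 0. The exponent [b] is general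
    because it grows along the induction. *)
Lemma alt_chain_chain_lim A B b : is_lim_seq (fun N =>
  RInt (fun w => mono b (gd w) * / cosh w * alt_chain N B A w) 0 (INR N) -
  (-1) ^ B * RInt (fun w => mono (b + B) (gd w) * / cosh w * mono A w) 0 (INR N)) 0.
Proof.
  revert b; induction B as [|B IH]; intros b.
  - apply is_lim_seq_ext with (fun _ => 0); [|apply is_lim_seq_const].
    intros N; rewrite Nat.add_0_r, pow_O, Rmult_1_l.
    rewrite (RInt_ext (fun w => mono b (gd w) * / cosh w * alt_chain N 0 A w)
      (fun w => mono b (gd w) * / cosh w * mono A w)); [ring|].
    intros w _; now rewrite alt_chain_0.
  - assert (H := alt_chain_by_parts_lim (fun w => mono (S b) (gd w)) (fun w => mono b (gd w))
      (is_derive_mono_gd b) (ex_derive_mono_gd b) (mono (S b) (PI / 2))).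
    assert (Hb : forall w, 0 <= w -> Rabs (mono (S b) (gd w)) <= mono (S b) (PI / 2)).
    { intros w Hw; assert (Hg := gd_bounds w Hw).
      rewrite Rabs_pos_eq by now apply mono_nonneg. now apply mono_incr. }
    specialize (H Hb B A).
    assert (H2 := is_lim_seq_scal_0 (-1) _ (IH (S b))).
    assert (H3 := is_lim_seq_plus_0 _ _ H H2).
    eapply is_lim_seq_ext; [|exact H3].
    intros N; cbv beta. rewrite gd_0, mono_S_0. rewrite <- tech_pow_Rmult.
    replace (b + S B)%nat with (S b + B)%nat by lia. ring.
Qed.

(** At w = 0 [alt_chain] is the truncated series of W. With [phi] = 1 it becomes minus the integral
    of the depth B combination against dw / cosh w, whose depth is then stripped off starting from
    v^0. *)
Lemma W_integral A B : is_lim_seq (fun N =>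
  (-1) ^ S B * RInt (fun w => mono B (gd w) * / cosh w * mono A w) 0 (INR N)) (W (A + S B) (S B)).
Proof.
  assert (H1 := alt_chain_by_parts_lim (fun _ => 1) (fun _ => 0)).
  assert (Hd : forall w, is_derive (fun _ : R => 1) w (0 * / cosh w)).
  { intros w; rewrite Rmult_0_l; apply (is_derive_const 1). }
  specialize (H1 Hd (fun w => ex_derive_const 0 w) 1).
  assert (Hc : forall w, 0 <= w -> Rabs 1 <= 1) by (intros; rewrite Rabs_R1; lra).
  specialize (H1 Hc B A).
  assert (H2 := alt_chain_chain_lim A B 0).
  assert (H3 := is_lim_seq_W B A).
  assert (H4 := is_lim_seq_minus' _ _ _ _ H2 H1).
  assert (H5 := is_lim_seq_plus' _ _ _ _ H3 H4).
  replace (W (A + S B) (S B)) with (W (A + S B) (S B) + (0 - 0)) by ring.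
  eapply is_lim_seq_ext; [|exact H5].
  intros N; cbv beta. rewrite Nat.add_0_l, alt_chain_S_at_0, <- tech_pow_Rmult.
  rewrite (RInt_ext (fun w => 0 * / cosh w * alt_chain N (S B) A w) (fun _ => 0)) by (intros; rewrite !Rmult_0_l; reflexivity).
  rewrite (RInt_ext (fun w => mono 0 (gd w) * / cosh w * alt_chain N B A w)
     (fun w => 1 * / cosh w * alt_chain N B A w)) by (intros; now rewrite mono_0).
  rewrite RInt_const. unfold scal; simpl; unfold mult; simpl. ring.
Qed.

(** * The coefficients [Zjp] and the Fourier series *)

Lemma incr_lists_nil l lo hi : (S hi - lo < l)%nat -> incr_lists l lo hi = [].
Proof.
  revert lo; induction l as [|l IH]; intros lo H; [lia|].
  cbn [incr_lists].
  assert (E : forall s, (forall a, In a s -> (lo <= a <= hi)%nat) ->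
     flat_map (fun a => map (cons a) (incr_lists l (S a) hi)) s = []).
  { induction s as [|a s IHs]; intros Hs; [reflexivity|].
    cbn [flat_map]. assert (Ha := Hs a (or_introl eq_refl)).
    rewrite IH by lia. apply IHs; intros; apply Hs; now right. }
  apply E; intros a Ha; apply in_seq in Ha; lia.
Qed.

(** Here [k] counts the intermediate points, hence k + 1 steps and the power (-2)^(k+1) in what
    follows. *)
Definition chain_total (k j p : nat) : R :=
  Rsum_list (map (fun mids => chain_prod j (mids ++ [p])) (incr_lists k (S j) (p - 1))).

Lemma chain_total_0 j p : chain_total 0 j p = zetabar (2 * p - 2 * j).
Proof. unfold chain_total, Rsum_list; simpl; ring. Qed.

Lemma chain_total_S k j p : (j < p)%nat -> chain_total (S k) j p =
  bsum (p - 1 - j) (fun i => zetabar (2 * (S j + i) - 2 * j) * chain_total k (S j + i) p).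
Proof.
  intros H; unfold chain_total at 1; cbn [incr_lists].
  rewrite Rsum_list_flat_map, Rsum_list_seq.
  replace (S (p - 1) - S j)%nat with (p - 1 - j)%nat by lia.
  apply bsum_ext; intros i _; unfold chain_total.
  rewrite map_map, <- Rsum_list_scal; reflexivity.
Qed.

(** Chains with p - j or more intermediate points do not exist, so the range may be enlarged freely.
    A common range for all starting points lets the sums be exchanged in the recursion. *)
Lemma Zjp_chain_total j p n : (j < p)%nat -> (p - j <= n)%nat ->
  Zjp j p = bsum n (fun k => (-2) ^ S k * chain_total k j p).
Proof.
  intros H Hn; unfold Zjp; destruct (Nat.eqb_spec j p); [lia|].
  rewrite Rsum_list_seq, (bsum_tail_zero (p - j) n); [|assumption|].
  - apply bsum_ext; intros k _; unfold chain_total.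
    replace (1 + k - 1)%nat with k by lia; reflexivity.
  - intros k Hk; unfold chain_total; rewrite incr_lists_nil by lia; unfold Rsum_list; simpl; ring.
Qed.

Lemma Zjp_diag p : Zjp p p = 1.
Proof. unfold Zjp; now rewrite Nat.eqb_refl. Qed.

(** Chains are sorted by their first step; the one-step chain is the last summand, through Z(p,p) =
    1. On generating functions this is the inversion of 1 + 2 sum_i zetabar(2i) x^(2i). *)
Lemma Zjp_rec j d : Zjp j (j + S d) =
  -2 * bsum (S d) (fun i => zetabar (2 * S i) * Zjp (j + S i) (j + S d)).
Proof.
  set (p := (j + S d)%nat).
  rewrite (Zjp_chain_total j p (S d)), bsum_S_l, chain_total_0 by lia.
  rewrite (bsum_ext d _ (fun k => bsum d (fun i =>
    -2 * (zetabar (2 * S i) * ((-2) ^ S k * chain_total k (j + S i) p))))).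
  - rewrite bsum_swap, bsum_S, Rmult_plus_distr_l, Rplus_comm.
    replace (j + S d)%nat with p by reflexivity. rewrite Zjp_diag.
    replace (2 * p - 2 * j)%nat with (2 * S d)%nat by lia.
    f_equal; [|simpl; ring].
    rewrite <- bsum_scal; apply bsum_ext; intros i Hi.
    rewrite bsum_scal, bsum_scal, <- Zjp_chain_total by lia; reflexivity.
  - intros k Hk; rewrite chain_total_S by lia.
    replace (p - 1 - j)%nat with d by lia.
    rewrite <- bsum_scal; apply bsum_ext; intros i _.
    replace (2 * (S j + i) - 2 * j)%nat with (2 * S i)%nat by lia.
    replace (S j + i)%nat with (j + S i)%nat by lia.
    rewrite <- (tech_pow_Rmult _ (S k)); ring.
Qed.

Lemma Zjp_shift j d : Zjp j (j + d) = Zjp 0 d.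
Proof.
  revert j; induction d as [d IH] using (well_founded_induction lt_wf); intros j.
  destruct d as [|d]; [now rewrite Nat.add_0_r, !Zjp_diag|].
  rewrite Zjp_rec. change (Zjp 0 (S d)) with (Zjp 0 (0 + S d)); rewrite Zjp_rec.
  f_equal; apply bsum_ext; intros i Hi; f_equal.
  replace (j + S d)%nat with ((j + S i) + (d - i))%nat by lia.
  replace (0 + S d)%nat with ((0 + S i) + (d - i))%nat by lia.
  rewrite !IH by lia; reflexivity.
Qed.

(* [Zjp j p] depends only on [p - j]. *)
Definition zcoef (d : nat) : R := Zjp 0 d.

Lemma zcoef_0 : zcoef 0 = 1.
Proof. apply Zjp_diag. Qed.

(** With the convention zetabar(0) = 1/2 this says that the convolution of zetabar(2i) with [zcoef]
    vanishes in every positive degree. *)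
Lemma zcoef_S d : zcoef (S d) = - 2 * bsum (S d) (fun i => zetabar (2 * S i) * zcoef (d - i)).
Proof.
  unfold zcoef; change (Zjp 0 (S d)) with (Zjp 0 (0 + S d)); rewrite Zjp_rec.
  f_equal; apply bsum_ext; intros i Hi; f_equal.
  replace (0 + S d)%nat with ((0 + S i) + (d - i))%nat by lia; apply Zjp_shift.
Qed.

Lemma Zjp_zcoef j p : (j <= p)%nat -> Zjp j p = zcoef (p - j).
Proof. intros H; replace p with (j + (p - j))%nat at 1 by lia; apply Zjp_shift. Qed.

(** * Alternating zeta values and truncated Fourier series *)

Lemma is_lim_seq_zetabar s : (1 <= s)%nat ->
  is_lim_seq (fun N => bsum N (fun n => (-1) ^ n / INR (S n) ^ s)) (zetabar s).
Proof.
  intros Hs.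
  assert (Hex : ex_finite_lim_seq (fun N => bsum N (fun n => (-1) ^ S n * / INR (S n) ^ s))).
  (* The terms are monotone, so no correcting sequence is necessary. *)
  { apply ex_lim_alternating with (g := fun _ => 0).
    - apply is_lim_seq_0_squeeze with (fun i => / INR (S i)); [|apply is_lim_seq_inv_INR_S].
      intros i; assert (H := one_le_INR_S i).
      destruct (inv_pow_le_inv (INR (S i)) (INR (S i)) s) as [H1 H2]; [lra|lra|assumption|].
      rewrite Rabs_pos_eq; lra.
    - apply is_lim_seq_const.
    - intros; lra.
    - intros i; rewrite Rminus_0_r. assert (H := one_le_INR_S i).
      enough (/ INR (S (S i)) ^ s <= / INR (S i) ^ s) by lra.
      apply Rinv_le_contravar; [apply pow_lt; lra|].
      apply pow_incr; rewrite (S_INR (S i)); lra. }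
  destruct Hex as [l Hl].
  assert (Hl' : is_lim_seq (fun N => bsum N (fun n => (-1) ^ n / INR (S n) ^ s)) (- l)).
  { apply is_lim_seq_opp in Hl; simpl in Hl. eapply is_lim_seq_ext; [|exact Hl].
    intros N; simpl. rewrite <- (Rmult_1_l (bsum N _)), Ropp_mult_distr_l, <- bsum_scal.
    apply bsum_ext; intros n _; unfold Rdiv; ring. }
  replace (zetabar s) with (- l); [assumption|].
  destruct s as [|s]; [lia|]. unfold zetabar.
  rewrite (Lim_seq_ext _ (fun N => bsum N (fun n => (-1) ^ n / INR (S n) ^ S s))).
  - now rewrite (is_lim_seq_unique _ _ Hl').
  - intros N; rewrite Rsum_list_seq; apply bsum_ext; intros n _.
    replace (1 + n - 1)%nat with n by lia; reflexivity.
Qed.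

(** The odd exponent is written 2 i + 1 so that i = 0 is the sawtooth series of v; the sign is
    (-1)^(n-1) in terms of the true index n. *)
Definition sine_sum (N i : nat) (v : R) : R :=
  2 * bsum N (fun n => (-1) ^ n * (sin (INR (S n) * v) / INR (S n) ^ (2 * i + 1))).

Definition cosine_sum (N i : nat) (v : R) : R :=
  2 * bsum N (fun n => (-1) ^ n * (cos (INR (S n) * v) / INR (S n) ^ (2 * i))).

Lemma is_derive_sine_sum N i v : is_derive (sine_sum N i) v (cosine_sum N i v).
Proof.
  apply (is_derive_scal (fun v => bsum N (fun n =>
    (-1) ^ n * (sin (INR (S n) * v) / INR (S n) ^ (2 * i + 1))))).
  apply (is_derive_bsum N (fun n v => (-1) ^ n * (sin (INR (S n) * v) / INR (S n) ^ (2 * i + 1)))).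
  intros n _; assert (H := one_le_INR_S n).
  apply (is_derive_scal (fun v => sin (INR (S n) * v) / INR (S n) ^ (2 * i + 1))).
  rewrite Nat.add_1_r, <- tech_pow_Rmult.
  assert (Hp : INR (S n) ^ (2 * i) <> 0) by (apply pow_nonzero; lra).
  revert H Hp; generalize (INR (S n) ^ (2 * i)) as y; generalize (INR (S n)) as x; intros x y H Hp.
  auto_derive; [trivial|]. field; lra.
Qed.

Lemma is_derive_cosine_sum N i v : is_derive (cosine_sum N (S i)) v (- sine_sum N i v).
Proof.
  evar_last.
  - apply (is_derive_scal (fun v => bsum N (fun n =>
      (-1) ^ n * (cos (INR (S n) * v) / INR (S n) ^ (2 * S i))))).
    apply (is_derive_bsum N (fun n v => (-1) ^ n * (cos (INR (S n) * v) / INR (S n) ^ (2 * S i)))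
      (fun n => - ((-1) ^ n * (sin (INR (S n) * v) / INR (S n) ^ (2 * i + 1))))).
    intros n _; assert (H := one_le_INR_S n).
    rewrite Ropp_mult_distr_r.
    apply (is_derive_scal (fun v => cos (INR (S n) * v) / INR (S n) ^ (2 * S i))).
    replace (2 * S i)%nat with (S (2 * i + 1)) by lia. rewrite <- tech_pow_Rmult.
    assert (Hp : INR (S n) ^ (2 * i + 1) <> 0) by (apply pow_nonzero; lra).
    revert H Hp; generalize (INR (S n) ^ (2 * i + 1)) as y; generalize (INR (S n)) as x; intros x y H Hp.
    auto_derive; [trivial|]. field; lra.
  - unfold sine_sum. rewrite (bsum_ext N _ (fun n => -1 * ((-1) ^ n * (sin (INR (S n) * v) / INR (S n) ^ (2 * i + 1)))))
      by (intros; ring).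
    rewrite bsum_scal; ring.
Qed.

Lemma sine_sum_at_0 N i : sine_sum N i 0 = 0.
Proof.
  unfold sine_sum; rewrite bsum_zero; [ring|intros n _].
  rewrite Rmult_0_r, sin_0; unfold Rdiv; ring.
Qed.

Lemma is_lim_seq_cosine_sum_at_0 i : is_lim_seq (fun N => cosine_sum N (S i) 0) (2 * zetabar (2 * S i)).
Proof.
  apply (is_lim_seq_scal_l _ 2 (zetabar (2 * S i))).
  eapply is_lim_seq_ext; [|apply is_lim_seq_zetabar; lia].
  intros N; apply bsum_ext; intros n _. rewrite Rmult_0_r, cos_0; unfold Rdiv; ring.
Qed.

Lemma abs_diff_le_derive (f f' : R -> R) K v : 0 <= v ->
  (forall x, 0 <= x <= v -> is_derive f x (f' x)) ->
  (forall x, 0 <= x <= v -> Rabs (f' x) <= K) -> Rabs (f v - f 0) <= K * v.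
Proof.
  intros Hv Hd Hb; destruct (Req_dec v 0) as [->|Hv0].
  - rewrite Rminus_diag, Rabs_R0; lra.
  - destruct (MVT_cor2 f f' 0 v) as [c [Hc1 Hc2]]; [lra|intros; apply is_derive_Reals, Hd; lra|].
    rewrite Hc1, Rminus_0_r, Rabs_mult, (Rabs_pos_eq v) by lra.
    apply Rmult_le_compat_r; [assumption|apply Hb; lra].
Qed.

(** Uniformity is required exactly on [0, pi/2], where [gd] takes its values for w >= 0. *)
Definition unif0 (D : nat -> R -> R) : Prop :=
  exists eps : nat -> R, is_lim_seq eps 0 /\
    forall N v, 0 <= v <= PI / 2 -> Rabs (D N v) <= eps N.

Lemma unif0_plus D E : unif0 D -> unif0 E -> unif0 (fun N v => D N v + E N v).
Proof.
  intros [d [Hd HD]] [e [He HE]]; exists (fun N => d N + e N); split.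
  - now apply is_lim_seq_plus_0.
  - intros N v Hv; eapply Rle_trans; [apply Rabs_triang|].
    apply Rplus_le_compat; auto.
Qed.

Lemma unif0_scal c D : unif0 D -> unif0 (fun N v => c * D N v).
Proof.
  intros [d [Hd HD]]; exists (fun N => Rabs c * d N); split.
  - now apply is_lim_seq_scal_0.
  - intros N v Hv; rewrite Rabs_mult; apply Rmult_le_compat_l; [apply Rabs_pos|auto].
Qed.

Lemma unif0_ext D E : (forall N v, D N v = E N v) -> unif0 D -> unif0 E.
Proof.
  intros H [d [Hd HD]]; exists d; split; [assumption|]; intros; rewrite <- H; auto.
Qed.

Lemma alternating_dirichlet_kernel N v :
  cos (v / 2) * (1 - 2 * bsum N (fun n => (-1) ^ n * cos (INR (S n) * v))) =
  (-1) ^ N * cos ((INR N + / 2) * v).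
Proof.
  induction N as [|N IH].
  - cbn [bsum pow INR]. replace ((0 + / 2) * v) with (v / 2) by field. ring.
  - rewrite bsum_S, <- tech_pow_Rmult, !S_INR.
    replace (cos (v / 2) * (1 - 2 * (bsum N (fun n => (-1) ^ n * cos (INR (S n) * v)) +
      (-1) ^ N * cos ((INR N + 1) * v)))) with
      (cos (v / 2) * (1 - 2 * bsum N (fun n => (-1) ^ n * cos (INR (S n) * v))) -
       (-1) ^ N * (2 * cos ((INR N + 1) * v) * cos (v / 2))) by ring.
    rewrite IH.
    replace ((INR N + / 2) * v) with ((INR N + 1) * v - v / 2) by field.
    replace ((INR N + 1 + / 2) * v) with ((INR N + 1) * v + v / 2) by field.
    rewrite cos_minus, cos_plus; ring.
Qed.

Lemma cos_half_bounds v : 0 <= v <= PI / 2 -> / 2 <= cos (v / 2) /\ / 2 <= cos (v / 2) * cos (v / 2).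
Proof.
  intros Hv; assert (HPI := PI_RGT_0).
  assert (H0 : 0 < cos (v / 2)) by (apply cos_gt_0; lra).
  assert (H1 := COS_bound (v / 2)).
  assert (H2 : 0 <= cos v) by (apply cos_ge_0; lra).
  assert (H3 : cos v = 2 * cos (v / 2) * cos (v / 2) - 1).
  { rewrite <- cos_2a_cos; f_equal; field. }
  split; nra.
Qed.

(** Termwise bounds fail, since the series is not absolutely convergent. The Dirichlet kernel gives
    v - [sine_sum N 0 v] the derivative (-1)^N cos(L v) / cos(v/2) with L = N + 1/2, and this
    oscillation gains a factor 1/L because cos(v/2) >= 1/2. *)
Lemma unif0_sine_sum_0 : unif0 (fun N v => sine_sum N 0 v - v).
Proof.
  exists (fun N => 8 * / INR (S N)); split; [apply is_lim_seq_scal_0, is_lim_seq_inv_INR_S|].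
  intros N v Hv.
  assert (HPI := PI_4). assert (HN := pos_INR N).
  set (L := INR N + / 2). assert (HL : 0 < L) by (unfold L; lra).
  set (s := (-1) ^ N). assert (Hs : Rabs s = 1) by apply pow_1_abs.
  (* Subtracting the leading term of the primitive is an integration by parts: the derivative of F
     is O(1/L). With v <= 2, both F and the subtracted term are at most 2/L, and 4/L = 8/(2 N + 1)
     <= 8/(N + 1). *)
  set (F := fun v => v - sine_sum N 0 v - s * (sin (L * v) / (L * cos (v / 2)))).
  assert (HF : forall x, 0 <= x <= PI / 2 -> is_derive F x
     (- (s * (sin (L * x) * sin (x / 2) / (2 * L * (cos (x / 2) * cos (x / 2))))))).
  { intros x Hx. destruct (cos_half_bounds x Hx) as [Hc _].
    evar_last.
    - apply (is_derive_minus (fun v => v - sine_sum N 0 v) (fun v => s * (sin (L * v) / (L * cos (v / 2))))).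
      + apply (is_derive_minus (fun v => v) (sine_sum N 0)); [apply (is_derive_id x)|apply is_derive_sine_sum].
      + apply (is_derive_scal (fun v => sin (L * v) / (L * cos (v / 2)))).
        instantiate (1 := cos (L * x) / cos (x / 2) +
           sin (L * x) * sin (x / 2) / (2 * L * (cos (x / 2) * cos (x / 2)))).
        auto_derive; [apply Rgt_not_eq; apply Rmult_lt_0_compat; [assumption|]; unfold Rdiv in *; lra|].
        unfold Rdiv; simpl; field; unfold Rdiv in *; split; lra.
    - assert (E : 1 - cosine_sum N 0 x = s * cos (L * x) / cos (x / 2)).
      { unfold s, L; rewrite <- alternating_dirichlet_kernel. unfold cosine_sum.
        rewrite (bsum_ext N _ (fun n => (-1) ^ n * cos (INR (S n) * x))).
        - field; lra.
        - intros n _; simpl pow; unfold Rdiv; rewrite Rinv_1; ring. }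
      unfold minus, plus, opp, one; simpl. unfold Rminus in E; rewrite E. unfold Rdiv; ring. }
  assert (HFb : Rabs (F v - F 0) <= / L * v).
  { apply abs_diff_le_derive with (f' := fun x =>
      - (s * (sin (L * x) * sin (x / 2) / (2 * L * (cos (x / 2) * cos (x / 2))))));
      [lra|intros; apply HF; lra|].
    intros x Hx. destruct (cos_half_bounds x) as [_ Hc]; [lra|].
    rewrite Rabs_Ropp, Rabs_mult, Hs, Rmult_1_l; unfold Rdiv at 1.
    rewrite !Rabs_mult, (Rabs_pos_eq (/ _)).
    - apply Rle_trans with (1 * 1 * / L).
      + apply Rmult_le_compat.
        * apply Rmult_le_pos; apply Rabs_pos.
        * apply Rlt_le, Rinv_0_lt_compat; nra.
        * apply Rmult_le_compat; try apply Rabs_pos; apply Rabs_le, SIN_bound.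
        * apply Rinv_le_contravar; nra.
      + lra.
    - apply Rlt_le, Rinv_0_lt_compat; nra. }
  assert (F0 : F 0 = 0).
  { unfold F; rewrite sine_sum_at_0, Rmult_0_r, sin_0; unfold Rdiv; ring. }
  rewrite F0, Rminus_0_r in HFb.
  replace (sine_sum N 0 v - v) with (- (F v + s * (sin (L * v) / (L * cos (v / 2))))) by (unfold F; ring).
  rewrite Rabs_Ropp. eapply Rle_trans; [apply Rabs_triang|].
  destruct (cos_half_bounds v Hv) as [Hc _].
  assert (H2 : Rabs (s * (sin (L * v) / (L * cos (v / 2)))) <= 2 * / L).
  { rewrite Rabs_mult, Hs, Rmult_1_l; unfold Rdiv at 1.
    rewrite Rabs_mult, (Rabs_pos_eq (/ _)) by (apply Rlt_le, Rinv_0_lt_compat; nra).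
    replace (2 * / L) with (1 * / (L * / 2)) by (field; lra).
    apply Rmult_le_compat; [apply Rabs_pos|apply Rlt_le, Rinv_0_lt_compat; nra|apply Rabs_le, SIN_bound|].
    apply Rinv_le_contravar; nra. }
  assert (HiL : 0 < / L) by now apply Rinv_0_lt_compat.
  apply Rle_trans with (4 * / L); [nra|].
  replace (4 * / L) with (8 * / (2 * L)) by (field; lra).
  apply Rmult_le_compat_l; [lra|].
  apply Rinv_le_contravar; unfold L; rewrite S_INR; lra.
Qed.

Definition zcoef_sine_sum (N m : nat) (v : R) : R := bsum (S m) (fun i => zcoef (m - i) * sine_sum N i v).

(** The error for m + 1 has minus the error for m as second derivative and is recovered by
    integrating twice from 0. The sawtooth summand, whose differentiated partial sums do not
    converge, is first replaced by its limit v in [H] and restored at the end. *)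
Lemma unif0_zcoef_sine_sum m : unif0 (fun N v => zcoef_sine_sum N m v - (-1) ^ m * mono (2 * m + 1) v).
Proof.
  induction m as [|m IH].
  - eapply unif0_ext; [|exact unif0_sine_sum_0].
    intros N v; unfold zcoef_sine_sum; rewrite bsum_S. cbn [bsum Nat.sub].
    rewrite zcoef_0. unfold mono; simpl; field.
  - set (H := fun N v => zcoef (S m) * v + bsum (S m) (fun i => zcoef (m - i) * sine_sum N (S i) v)
       - (-1) ^ S m * mono (2 * S m + 1) v).
    set (H1 := fun N v => zcoef (S m) + bsum (S m) (fun i => zcoef (m - i) * cosine_sum N (S i) v)
       - (-1) ^ S m * mono (2 * S m) v).
    assert (D1 : forall N v, is_derive (H N) v (H1 N v)).
    { intros N v. apply (is_derive_minus (fun v => zcoef (S m) * v + bsum (S m) (fun i => zcoef (m - i) * sine_sum N (S i) v))).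
      - apply (is_derive_plus (fun v => zcoef (S m) * v)).
        + auto_derive; [trivial|ring].
        + apply (is_derive_bsum (S m) (fun i v => zcoef (m - i) * sine_sum N (S i) v)).
          intros i _; apply (is_derive_scal (sine_sum N (S i))), is_derive_sine_sum.
      - apply (is_derive_scal (mono (2 * S m + 1))). rewrite Nat.add_1_r; apply is_derive_mono_S. }
    assert (D2 : forall N v, is_derive (H1 N) v (- (zcoef_sine_sum N m v - (-1) ^ m * mono (2 * m + 1) v))).
    { intros N v. evar_last.
      - apply (is_derive_minus (fun v => zcoef (S m) + bsum (S m) (fun i => zcoef (m - i) * cosine_sum N (S i) v))).
        + apply (is_derive_plus (fun _ => zcoef (S m))); [apply (is_derive_const (zcoef (S m)))|].
          apply (is_derive_bsum (S m) (fun i v => zcoef (m - i) * cosine_sum N (S i) v)).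
          intros i _; apply (is_derive_scal (cosine_sum N (S i))), is_derive_cosine_sum.
        + apply (is_derive_scal (mono (2 * S m))).
          replace (2 * S m)%nat with (S (2 * m + 1)) by lia; apply is_derive_mono_S.
      - unfold zcoef_sine_sum. rewrite (bsum_ext (S m) (fun i => zcoef (m - i) * - sine_sum N i v) (fun i => -1 * (zcoef (m - i) * sine_sum N i v)))
          by (intros; ring).
        rewrite bsum_scal, <- tech_pow_Rmult. unfold minus, plus, opp, zero; simpl; ring. }
    destruct IH as [eps [Heps IH]].
    assert (HH : unif0 H).
    { exists (fun N => 2 * (Rabs (H1 N 0) + 2 * eps N)); split.
      - apply is_lim_seq_scal_0, is_lim_seq_plus_0; [|now apply is_lim_seq_scal_0].
        replace (Finite 0) with (Rbar_abs 0) by (simpl; now rewrite Rabs_R0).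
        apply is_lim_seq_abs.
        assert (L := is_lim_seq_bsum (S m) (fun i N => zcoef (m - i) * cosine_sum N (S i) 0)
           (fun i => zcoef (m - i) * (2 * zetabar (2 * S i)))).
        assert (L1 := is_lim_seq_plus' _ _ _ _ (is_lim_seq_const (zcoef (S m)))
          (L (fun i _ => is_lim_seq_scal_l _ (zcoef (m - i)) _ (is_lim_seq_cosine_sum_at_0 i)))).
        (* The value at 0 of the limiting cosine combination cancels by the recursion of [zcoef];
           this is the only place where the specific values of Z matter. *)
        replace (zcoef (S m) + bsum (S m) (fun i => zcoef (m - i) * (2 * zetabar (2 * S i)))) with 0 in L1.
        + eapply is_lim_seq_ext; [|exact L1]. intros N; unfold H1.
          replace (2 * S m)%nat with (S (2 * m + 1)) by lia. rewrite mono_S_0; ring.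
        + rewrite zcoef_S, <- bsum_scal, <- bsum_plus. symmetry; apply bsum_zero; intros; ring.
      - intros N v Hv. assert (HPI := PI_4).
        assert (He : 0 <= eps N) by (eapply Rle_trans; [apply Rabs_pos|apply (IH N v Hv)]).
        assert (B1 : forall x, 0 <= x <= v -> Rabs (H1 N x) <= Rabs (H1 N 0) + 2 * eps N).
        { intros x Hx.
          assert (B2 : Rabs (H1 N x - H1 N 0) <= eps N * x).
          { apply abs_diff_le_derive with (f' := fun x => - (zcoef_sine_sum N m x - (-1) ^ m * mono (2 * m + 1) x));
              [lra|intros; apply D2|]. intros y Hy; rewrite Rabs_Ropp; apply IH; lra. }
          replace (H1 N x) with (H1 N 0 + (H1 N x - H1 N 0)) by ring.
          eapply Rle_trans; [apply Rabs_triang|]. nra. }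
        assert (B0 := abs_diff_le_derive (H N) (H1 N) _ v ltac:(lra) (fun x _ => D1 N x) B1).
        replace (H N 0) with 0 in B0.
        + rewrite Rminus_0_r in B0. assert (Hp := Rabs_pos (H1 N 0)). nra.
        + unfold H. rewrite Nat.add_1_r, mono_S_0, bsum_zero; [ring|].
          intros i _; rewrite sine_sum_at_0; ring. }
    eapply unif0_ext; [|exact (unif0_plus _ _ HH (unif0_scal (zcoef (S m)) _ unif0_sine_sum_0))].
    intros N v; cbv beta. unfold H, zcoef_sine_sum. rewrite (bsum_S_l (S m)), Nat.sub_0_r.
    cbn [Nat.sub]. ring.
Qed.

(** * Fubini and the symmetric kernel *)

Lemma continuous_of_eps (g : R -> R) c :
  (forall eps : posreal, exists d : posreal, forall x, Rabs (x - c) < d -> Rabs (g x - g c) < eps) ->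
  continuous g c.
Proof.
  intros H; apply filterlim_locally; intros eps; destruct (H eps) as [d Hd].
  exists d; intros x Hx; apply Hd, Hx.
Qed.

Lemma continuity_2d_pt_flip (f : R -> R -> R) x y :
  continuity_2d_pt f x y -> continuity_2d_pt (fun u v => f v u) y x.
Proof. intros H eps; destruct (H eps) as [d Hd]; exists d; intros u v Hu Hv; now apply Hd. Qed.

Lemma continuity_2d_pt_continuous_r (f : R -> R -> R) x y :
  continuity_2d_pt f x y -> continuous (f x) y.
Proof.
  intros H; apply continuous_of_eps; intros eps; destruct (H eps) as [d Hd].
  exists d; intros t Ht; apply Hd; [|assumption]. rewrite Rminus_diag, Rabs_R0; apply cond_pos.
Qed.

Section Fubini.

Variable f : R -> R -> R.
Hypothesis Hf : forall x y, continuity_2d_pt f x y.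

Lemma ex_RInt_section x a b : ex_RInt (f x) a b.
Proof.
  apply (@ex_RInt_continuous R_CompleteNormedModule); intros y _.
  apply continuity_2d_pt_continuous_r, Hf.
Qed.

Lemma continuous_RInt_param_le a b c : a <= b -> continuous (fun x => RInt (f x) a b) c.
Proof.
  intros Hab; apply continuous_of_eps; intros eps.
  (* The added 1 covers a = b and keeps the final estimate strict. *)
  assert (He : 0 < eps / (b - a + 1)) by (apply Rdiv_lt_0_compat; [apply cond_pos|lra]).
  destruct (uniform_continuity_2d_1d' f a b c (fun x _ => Hf c x) (mkposreal _ He)) as [d Hd].
  exists d; intros x Hx; simpl in Hd.
  assert (E : minus (RInt (f x) a b) (RInt (f c) a b) = RInt (fun y => minus (f x y) (f c y)) a b)
    by (symmetry; apply (RInt_minus (V := R_CompleteNormedModule)); apply ex_RInt_section).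
  unfold minus, plus, opp in E; simpl in E; unfold Rminus; rewrite E.
  apply Rle_lt_trans with ((b - a) * (eps / (b - a + 1))).
  - apply abs_RInt_le_const; [assumption| |].
    + apply (ex_RInt_minus (V := R_NormedModule) (f x) (f c)); apply ex_RInt_section.
    + intros t Ht; apply Rlt_le. apply Rabs_def2 in Hx. assert (Hd0 := cond_pos d).
      apply (Hd t c t x); try lra. rewrite Rminus_diag, Rabs_R0; apply cond_pos.
  - assert (H := cond_pos eps).
    apply Rmult_lt_reg_r with (b - a + 1); [lra|].
    replace ((b - a) * (eps / (b - a + 1)) * (b - a + 1)) with ((b - a) * eps) by (field; lra). lra.
Qed.

Lemma continuous_RInt_param a b c : continuous (fun x => RInt (f x) a b) c.
Proof.
  destruct (Rle_lt_dec a b) as [Hab|Hab]; [now apply continuous_RInt_param_le|].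
  apply continuous_ext with (fun x => opp (RInt (f x) b a)).
  - intros x; apply (opp_RInt_swap (V := R_CompleteNormedModule)), ex_RInt_section.
  - apply (continuous_opp (V := R_NormedModule) (fun x => RInt (f x) b a)).
    apply continuous_RInt_param_le; lra.
Qed.

End Fubini.

(** As functions of the upper limit in x both sides vanish at a and have the same derivative, by
    differentiation under the integral sign. *)
Lemma RInt_fubini (f : R -> R -> R) a b c d : (forall x y, continuity_2d_pt f x y) -> a <= b ->
  RInt (fun x => RInt (fun y => f x y) c d) a b = RInt (fun y => RInt (fun x => f x y) a b) c d.
Proof.
  intros Hf Hab.
  assert (Hf' : forall y x, continuity_2d_pt (fun y x => f x y) y x)
    by (intros; apply continuity_2d_pt_flip, Hf).
  set (h := fun x => RInt (fun y => f x y) c d).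
  assert (Hh : forall x, continuous h x) by (intros; now apply continuous_RInt_param).
  set (G := fun s y => RInt (fun x => f x y) a s).
  assert (DG : forall s y, is_derive (fun s => G s y) s (f s y)).
  { intros s y; apply (is_derive_RInt (fun x => f x y) _ a).
    - apply filter_forall; intros s'.
      apply (RInt_correct (V := R_CompleteNormedModule)), (ex_RInt_section (fun y x => f x y) Hf').
    - apply (continuity_2d_pt_continuous_r (fun y x => f x y)), Hf'. }
  set (D := fun s => RInt h a s - RInt (fun y => G s y) c d).
  assert (HD : forall s, is_derive D s 0).
  { intros s. evar_last.
    - apply (is_derive_minus (fun s => RInt h a s) (fun s => RInt (fun y => G s y) c d)).
      + apply (is_derive_RInt h _ a); [|apply Hh].
        apply filter_forall; intros s'; apply (RInt_correct (V := R_CompleteNormedModule)).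
        apply (@ex_RInt_continuous R_CompleteNormedModule); intros; apply Hh.
      + apply is_derive_RInt_param.
        * apply filter_forall; intros x t _; eexists; apply DG.
        * intros t _; apply continuity_2d_pt_ext with f; [|apply Hf].
          intros x y; symmetry; apply is_derive_unique, DG.
        * apply filter_forall; intros x.
          apply (@ex_RInt_continuous R_CompleteNormedModule); intros z _.
          apply (continuous_RInt_param (fun y x => f x y) Hf').
    - rewrite (RInt_ext (fun t => Derive (fun u => G u t) s) (fun t => f s t)).
      + unfold minus, plus, opp, h; simpl; ring.
      + intros t _; apply is_derive_unique, DG. }
  assert (Da : D a = 0).
  { unfold D, G; rewrite RInt_point.
    rewrite (RInt_ext _ (fun _ => 0)) by (intros; apply (RInt_point (V := R_CompleteNormedModule))).
    rewrite RInt_const; unfold scal, zero; simpl; unfold mult; simpl; ring. }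
  enough (E : D b = 0) by exact (Rminus_diag_uniq _ _ E).
  destruct Hab as [Hab| <-]; [|assumption].
  destruct (MVT_cor2 D (fun _ => 0) a b Hab) as [e [He _]];
    [intros; apply is_derive_Reals, HD|lra].
Qed.

(** Minus the t-derivative of [poisson t w], divided by cosh w. The Poisson kernel itself is not
    symmetric in t and w; differentiating it and removing cosh w makes it so. *)
Definition kappa (t w : R) : R := sinh t * sinh w / (cosh t * cosh w + 1) ^ 2.

Lemma kappa_sym t w : kappa t w = kappa w t.
Proof. unfold kappa; now rewrite (Rmult_comm (sinh t)), (Rmult_comm (cosh t)). Qed.

Lemma cosh_cosh_pos t w : 0 < cosh t * cosh w + 1.
Proof. assert (H := cosh_ge_1 t); assert (H1 := cosh_ge_1 w); nra. Qed.

Lemma is_derive_sinh w : is_derive sinh w (cosh w).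
Proof. apply is_derive_Reals, derivable_pt_lim_sinh. Qed.

Lemma is_derive_cosh w : is_derive cosh w (sinh w).
Proof. apply is_derive_Reals, derivable_pt_lim_cosh. Qed.

Lemma ex_derive_continuity_pt (f : R -> R) x : ex_derive f x -> continuity_pt f x.
Proof. intros H; apply continuity_pt_filterlim; now apply (ex_derive_continuous f). Qed.

Lemma continuity_2d_kappa t w : continuity_2d_pt kappa t w.
Proof.
  assert (C1 : forall g, (forall x, ex_derive g x) -> continuity_2d_pt (fun u _ => g u) t w).
  { intros g Hg; apply (continuity_1d_2d_pt_comp g (fun u _ => u));
      [apply ex_derive_continuity_pt, Hg|apply continuity_2d_pt_id1]. }
  assert (C2 : forall g, (forall x, ex_derive g x) -> continuity_2d_pt (fun _ v => g v) t w).
  { intros g Hg; apply (continuity_1d_2d_pt_comp g (fun _ v => v));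
      [apply ex_derive_continuity_pt, Hg|apply continuity_2d_pt_id2]. }
  assert (Hs : forall x, ex_derive sinh x) by (intros; eexists; apply is_derive_sinh).
  assert (Hc : forall x, ex_derive cosh x) by (intros; eexists; apply is_derive_cosh).
  apply (continuity_2d_pt_mult (fun t w => sinh t * sinh w) (fun t w => / (cosh t * cosh w + 1) ^ 2)).
  - apply (continuity_2d_pt_mult (fun t _ => sinh t) (fun _ w => sinh w)); auto.
  - apply (continuity_2d_pt_inv (fun t w => (cosh t * cosh w + 1) ^ 2)).
    + apply (continuity_1d_2d_pt_comp (fun x => x ^ 2) (fun t w => cosh t * cosh w + 1)).
      * apply ex_derive_continuity_pt; auto_derive; trivial.
      * apply (continuity_2d_pt_plus (fun t w => cosh t * cosh w)); [|apply continuity_2d_pt_const].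
        apply (continuity_2d_pt_mult (fun t _ => cosh t) (fun _ w => cosh w)); auto.
    + apply pow_nonzero; assert (H := cosh_cosh_pos t w); lra.
Qed.

Lemma continuity_2d_mono_kappa a b w t :
  continuity_2d_pt (fun w t => mono a w * (mono b t * kappa t w)) w t.
Proof.
  apply (continuity_2d_pt_mult (fun w _ => mono a w)).
  - apply (continuity_1d_2d_pt_comp (mono a) (fun u _ => u));
      [apply ex_derive_continuity_pt, ex_derive_mono|apply continuity_2d_pt_id1].
  - apply (continuity_2d_pt_mult (fun _ t => mono b t) (fun w t => kappa t w)).
    + apply (continuity_1d_2d_pt_comp (mono b) (fun _ v => v));
        [apply ex_derive_continuity_pt, ex_derive_mono|apply continuity_2d_pt_id2].
    + apply (continuity_2d_pt_flip kappa), continuity_2d_kappa.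
Qed.

Definition kappa_moment (N a b : nat) : R :=
  RInt (fun w => RInt (fun t => mono a w * (mono b t * kappa t w)) 0 (INR N)) 0 (INR N).

Lemma kappa_moment_sym N a b : kappa_moment N a b = kappa_moment N b a.
Proof.
  unfold kappa_moment; rewrite RInt_fubini; [|apply continuity_2d_mono_kappa|apply pos_INR].
  apply RInt_ext; intros w _; apply RInt_ext; intros t _. rewrite kappa_sym; simpl; ring.
Qed.

Lemma cos_gd w : cos (gd w) = / cosh w.
Proof.
  assert (He := exp_pos (- w)). unfold gd; rewrite cos_shift, sin_2a, sin_atan, cos_atan.
  assert (Hs : sqrt (1 + (exp (- w))²) * sqrt (1 + (exp (- w))²) = 1 + exp (- w) * exp (- w))
    by (rewrite sqrt_sqrt; unfold Rsqr; nra).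
  assert (Hs0 : 0 < sqrt (1 + (exp (- w))²)) by (apply sqrt_lt_R0; unfold Rsqr; nra).
  transitivity (2 * exp (- w) / (1 + exp (- w) * exp (- w))).
  - rewrite <- Hs; field; lra.
  - unfold cosh. assert (E : exp w = / exp (- w)) by (rewrite exp_Ropp, Rinv_inv; reflexivity).
    rewrite E; field; split; nra.
Qed.

Lemma sin_gd w : sin (gd w) = sinh w / cosh w.
Proof.
  assert (He := exp_pos (- w)). unfold gd; rewrite sin_shift, cos_2a, sin_atan, cos_atan.
  assert (Hs : sqrt (1 + (exp (- w))²) * sqrt (1 + (exp (- w))²) = 1 + exp (- w) * exp (- w))
    by (rewrite sqrt_sqrt; unfold Rsqr; nra).
  assert (Hs0 : 0 < sqrt (1 + (exp (- w))²)) by (apply sqrt_lt_R0; unfold Rsqr; nra).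
  transitivity ((1 - exp (- w) * exp (- w)) / (1 + exp (- w) * exp (- w))).
  - rewrite <- Hs; field; lra.
  - unfold cosh, sinh. assert (E : exp w = / exp (- w)) by (rewrite exp_Ropp, Rinv_inv; reflexivity).
    rewrite E; field; split; nra.
Qed.

(** * Expansion of the Poisson kernel *)

Definition poisson_sum (N : nat) (t v : R) : R :=
  2 * bsum N (fun n => (-1) ^ n * sin (INR (S n) * v) * exp (- INR (S n) * t)).

(** Both 2 cosh t e^(-n t) and 2 sin(n v) cos v are sums of their neighbours at n - 1 and n + 1, so
    under alternating signs only the ends survive. *)
Lemma poisson_sum_eq N t v :
  (cosh t + cos v) * poisson_sum N t v =
  sin v - (-1) ^ N * (exp (- INR N * t) * sin (INR (S N) * v) +
                      exp (- INR (S N) * t) * sin (INR N * v)).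
Proof.
  unfold poisson_sum; induction N as [|N IH].
  - cbn [bsum pow INR]. rewrite !Rmult_0_l, sin_0, Ropp_0, Rmult_0_l, exp_0, !Rmult_1_l. ring.
  - rewrite bsum_S, <- tech_pow_Rmult.
    transitivity ((cosh t + cos v) * (2 * bsum N (fun n => (-1) ^ n * sin (INR (S n) * v) * exp (- INR (S n) * t)))
      + (-1) ^ N * (2 * cosh t * exp (- INR (S N) * t) * sin (INR (S N) * v)
           + exp (- INR (S N) * t) * (2 * sin (INR (S N) * v) * cos v))); [ring|].
    rewrite IH.
    assert (E1 : 2 * cosh t * exp (- INR (S N) * t) = exp (- INR N * t) + exp (- INR (S (S N)) * t)).
    { unfold cosh. rewrite (S_INR (S N)), S_INR.
      replace (- INR N * t) with (t + - (INR N + 1) * t) by ring.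
      replace (- (INR N + 1 + 1) * t) with (- t + - (INR N + 1) * t) by ring.
      rewrite !exp_plus; field. }
    assert (E2 : 2 * sin (INR (S N) * v) * cos v = sin (INR (S (S N)) * v) + sin (INR N * v)).
    { rewrite (S_INR (S N)).
      replace ((INR (S N) + 1) * v) with (INR (S N) * v + v) by ring.
      replace (INR N * v) with (INR (S N) * v - v) by (rewrite S_INR; ring).
      rewrite sin_plus, sin_minus; ring. }
    rewrite E1, E2; ring.
Qed.

(** The kernel sin v / (cosh t + cos v) at v = gd w, where sin v = tanh w and cos v = 1 / cosh w. *)
Definition poisson (t w : R) : R := sinh w / (cosh t * cosh w + 1).

Lemma poisson_gd t w : (cosh t + cos (gd w)) * poisson t w = sin (gd w).
Proof.
  rewrite cos_gd, sin_gd; unfold poisson.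
  assert (H := cosh_cosh_pos t w); assert (H1 := cosh_ge_1 w). field; lra.
Qed.

Lemma poisson_remainder N t w : 0 <= t -> 0 <= w ->
  Rabs (poisson t w - poisson_sum N t (gd w)) <= 2 * exp (- INR N * t).
Proof.
  intros Ht Hw.
  assert (E := poisson_sum_eq N t (gd w)). rewrite <- (poisson_gd t w) in E.
  assert (Hc := cosh_ge_1 t).
  assert (Hv : 0 < cos (gd w)) by (rewrite cos_gd; apply inv_cosh_pos).
  set (D := cosh t + cos (gd w)) in *. assert (HD : 1 <= D) by (unfold D; lra).
  set (r := poisson t w - poisson_sum N t (gd w)).
  assert (Er : D * r = (-1) ^ N * (exp (- INR N * t) * sin (INR (S N) * gd w) +
                      exp (- INR (S N) * t) * sin (INR N * gd w))) by (unfold r; lra).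
  assert (Hb : Rabs (D * r) <= 2 * exp (- INR N * t)).
  { rewrite Er, Rabs_mult, pow_1_abs, Rmult_1_l.
    eapply Rle_trans; [apply Rabs_triang|]. rewrite !Rabs_mult.
    rewrite !(Rabs_pos_eq (exp _)) by apply Rlt_le, exp_pos.
    assert (H1 : Rabs (sin (INR (S N) * gd w)) <= 1) by apply Rabs_le, SIN_bound.
    assert (H2 : Rabs (sin (INR N * gd w)) <= 1) by apply Rabs_le, SIN_bound.
    assert (H3 := exp_pos (- INR N * t)); assert (H4 := exp_pos (- INR (S N) * t)).
    assert (H5 : exp (- INR (S N) * t) <= exp (- INR N * t)) by (apply exp_le; rewrite S_INR; nra).
    nra. }
  rewrite Rabs_mult, (Rabs_pos_eq D) in Hb by lra.
  assert (H := Rabs_pos r). nra.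
Qed.

Lemma poisson_bound t w : 0 <= w -> 0 <= poisson t w <= 2 * exp (- t).
Proof.
  intros Hw; assert (H := cosh_ge_1 t); assert (H1 := cosh_ge_1 w); assert (H2 := cosh_cosh_pos t w).
  assert (He1 : exp (- w) <= exp w) by (apply exp_le; lra).
  assert (He2 := exp_pos (- w)).
  assert (Hs : 0 <= sinh w <= cosh w) by (unfold sinh, cosh; lra).
  split; [apply Rle_mult_inv_pos; lra|].
  apply Rle_trans with (/ cosh t); [|apply inv_cosh_le_exp].
  unfold poisson. apply Rmult_le_reg_r with (cosh t * (cosh t * cosh w + 1)); [nra|].
  replace (sinh w / (cosh t * cosh w + 1) * (cosh t * (cosh t * cosh w + 1))) with (sinh w * cosh t) by (field; lra).
  replace (/ cosh t * (cosh t * (cosh t * cosh w + 1))) with (cosh t * cosh w + 1) by (field; lra).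
  nra.
Qed.

Lemma is_derive_poisson t w : is_derive (fun t => poisson t w) t (- (kappa t w * cosh w)).
Proof.
  assert (H := cosh_cosh_pos t w). unfold poisson, kappa, Rdiv.
  evar_last.
  - apply (is_derive_scal (fun t => / (cosh t * cosh w + 1))).
    apply (is_derive_inv (fun t => cosh t * cosh w + 1) t (sinh t * cosh w)); [|lra].
    evar_last.
    + apply (is_derive_plus (fun t => cosh t * cosh w) (fun _ => 1)).
      * apply (is_derive_scal_l cosh t (sinh t) (cosh w)), is_derive_cosh.
      * apply (is_derive_const 1).
    + unfold plus, zero, scal; simpl; unfold mult; simpl; ring.
  - simpl; field; lra.
Qed.

(** Integration by parts in t; the boundary term at 0 vanishes and the one at N is kept as an
    error. *)
Lemma RInt_mono_kappa a N w :
  RInt (fun t => mono (S a) t * kappa t w) 0 (INR N) * cosh w =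
  RInt (fun t => mono a t * poisson t w) 0 (INR N) - mono (S a) (INR N) * poisson (INR N) w.
Proof.
  set (f1 := fun t => mono a t * poisson t w).
  set (f2 := fun t => mono (S a) t * kappa t w).
  assert (D1 : forall t, ex_derive f1 t).
  { intros t; apply (ex_derive_mult (mono a)); [apply ex_derive_mono|eexists; apply is_derive_poisson]. }
  assert (C2 : forall t, continuous f2 t).
  { intros t; apply (continuous_mult (mono (S a)) (fun t => kappa t w)).
    - apply (ex_derive_continuous (mono (S a))), ex_derive_mono.
    - apply (continuity_2d_pt_continuous_r (fun w t => kappa t w)), continuity_2d_pt_flip, continuity_2d_kappa. }
  assert (I1 : ex_RInt f1 0 (INR N)) by now apply ex_RInt_of_ex_derive.
  assert (I2 : ex_RInt f2 0 (INR N)) by (apply (@ex_RInt_continuous R_CompleteNormedModule); intros; apply C2).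
  assert (I3 : ex_RInt (fun t => f2 t * cosh w) 0 (INR N)).
  { apply (ex_RInt_ext (fun t => scal (cosh w) (f2 t)));
      [intros; unfold scal; simpl; unfold mult; simpl; ring|now apply (ex_RInt_scal (V := R_NormedModule))]. }
  assert (H : is_RInt (fun t => f1 t - f2 t * cosh w) 0 (INR N)
     (minus (mono (S a) (INR N) * poisson (INR N) w) (mono (S a) 0 * poisson 0 w))).
  { apply (is_RInt_derive (fun t => mono (S a) t * poisson t w)).
    - intros t _; evar_last.
      + apply (is_derive_mult (mono (S a)) (fun t => poisson t w));
          [apply is_derive_mono_S|apply is_derive_poisson|exact Rmult_comm].
      + unfold plus, mult, f1, f2; simpl; ring.
    - intros t _; apply (continuous_minus (V := R_NormedModule) f1 (fun t => f2 t * cosh w)).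
      + now apply (ex_derive_continuous f1).
      + apply (continuous_mult f2 (fun _ => cosh w)); [apply C2|apply continuous_const]. }
  apply (@is_RInt_unique R_CompleteNormedModule) in H.
  rewrite (RInt_minus f1 (fun t => f2 t * cosh w)) in H by assumption.
  rewrite (RInt_ext (fun t => f2 t * cosh w) (fun t => scal (cosh w) (f2 t))) in H
    by (intros; unfold scal; simpl; unfold mult; simpl; ring).
  rewrite (RInt_scal f2) in H by assumption.
  rewrite mono_S_0 in H. unfold minus, plus, opp, scal in H; simpl in H; unfold mult in H; simpl in H.
  lra.
Qed.

Lemma ex_derive_mono_exp a x t : ex_derive (fun t => mono a t * exp (- x * t)) t.
Proof.
  apply (ex_derive_mult (mono a)); [apply ex_derive_mono|auto_derive; trivial].
Qed.

(** Integration by parts adds at most 2^(a+1) e^(-T/2) to the error at each step, and the factor 1/x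
    <= 1 does no harm, so the error at most doubles. Uniformity in x matters: N such integrals are
    added with T = N. *)
Lemma incomplete_gamma a x T : 1 <= x -> 0 <= T ->
  Rabs (RInt (fun t => mono a t * exp (- x * t)) 0 T - / x ^ S a) <= 2 ^ S a * exp (- T / 2).
Proof.
  intros Hx HT.
  assert (Hix : 0 < / x <= 1) by (split; [apply Rinv_0_lt_compat; lra|rewrite <- Rinv_1; apply Rinv_le_contravar; lra]).
  assert (He2 := exp_pos (- x * T)).
  induction a as [|a IH].
  - assert (I : is_RInt (fun t => mono 0 t * exp (- x * t)) 0 T
        (minus (- / x * exp (- x * T)) (- / x * exp (- x * 0)))).
    { apply (is_RInt_derive (fun t => - / x * exp (- x * t))).
      - intros t _; rewrite mono_0. auto_derive; [trivial|field; lra].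
      - intros t _; apply (ex_derive_continuous (fun t => mono 0 t * exp (- x * t))), ex_derive_mono_exp. }
    rewrite (is_RInt_unique _ _ _ _ I).
    unfold minus, plus, opp; simpl. rewrite Rmult_0_r, exp_0, !Rmult_1_r.
    replace (- / x * exp (- x * T) + - - / x - / x) with (- (/ x * exp (- x * T))) by ring.
    rewrite Rabs_Ropp, Rabs_pos_eq by nra.
    assert (exp (- x * T) <= exp (- T / 2)) by (apply exp_le; nra).
    assert (He3 := exp_pos (- T / 2)). nra.
  - assert (I : is_RInt (fun t => mono a t * exp (- x * t) - x * (mono (S a) t * exp (- x * t))) 0 T
        (minus (mono (S a) T * exp (- x * T)) (mono (S a) 0 * exp (- x * 0)))).
    { apply (is_RInt_derive (fun t => mono (S a) t * exp (- x * t))).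
      - intros t _; evar_last.
        + apply (is_derive_mult (mono (S a)) (fun t => exp (- x * t)) t (mono a t) (- x * exp (- x * t)));
            [apply is_derive_mono_S|auto_derive; [trivial|ring]|exact Rmult_comm].
        + unfold plus, mult; simpl; ring.
      - intros t _; apply (continuous_minus (V := R_NormedModule) (fun t => mono a t * exp (- x * t))
          (fun t => x * (mono (S a) t * exp (- x * t)))).
        + apply (ex_derive_continuous (fun t => mono a t * exp (- x * t))), ex_derive_mono_exp.
        + apply (ex_derive_continuous (fun t => x * (mono (S a) t * exp (- x * t)))).
          apply (ex_derive_scal (fun t => mono (S a) t * exp (- x * t))), ex_derive_mono_exp. }
    apply (@is_RInt_unique R_CompleteNormedModule) in I.
    rewrite (RInt_minus (fun t => mono a t * exp (- x * t))) in I.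
    2:{ apply ex_RInt_of_ex_derive, ex_derive_mono_exp. }
    2:{ apply ex_RInt_of_ex_derive; intros; apply (ex_derive_scal (fun t => mono (S a) t * exp (- x * t))), ex_derive_mono_exp. }
    rewrite (RInt_scal (V := R_CompleteNormedModule) (fun t => mono (S a) t * exp (- x * t))) in I
      by (apply ex_RInt_of_ex_derive, ex_derive_mono_exp).
    rewrite mono_S_0 in I.
    unfold minus, plus, opp, scal in I; simpl in I; unfold mult in I; simpl in I.
    set (Ia := RInt (fun t => mono a t * exp (- x * t)) 0 T) in *.
    set (Ib := RInt (fun t => mono (S a) t * exp (- x * t)) 0 T) in *.
    assert (EI : Ib - / x ^ S (S a) = / x * (Ia - / x ^ S a) - / x * (mono (S a) T * exp (- x * T))).
    { rewrite <- (tech_pow_Rmult x (S a)).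
      assert (Ib = / x * (Ia - mono (S a) T * exp (- x * T))).
      { apply Rmult_eq_reg_l with x; [|lra]. rewrite <- Rmult_assoc, Rinv_r, Rmult_1_l by lra. lra. }
      rewrite H, Rinv_mult. ring. }
    rewrite EI.
    assert (Hm := mono_nonneg (S a) T HT). assert (Hm2 := mono_le_exp_half (S a) T HT).
    assert (Hme : mono (S a) T * exp (- x * T) <= 2 ^ S a * exp (- T / 2)).
    { apply Rle_trans with (2 ^ S a * exp (T / 2) * exp (- T)).
      - apply Rmult_le_compat; [assumption|lra|assumption|apply exp_le; nra].
      - rewrite Rmult_assoc, <- exp_plus. right; do 2 f_equal; field. }
    assert (Hp : 0 <= mono (S a) T * exp (- x * T)) by nra.
    unfold Rminus at 1; eapply Rle_trans; [apply Rabs_triang|].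
    rewrite Rabs_Ropp, !Rabs_mult, (Rabs_pos_eq (/ x)) by lra.
    rewrite (Rabs_pos_eq (mono _ _)), (Rabs_pos_eq (exp _)) by lra.
    rewrite <- (tech_pow_Rmult 2 (S a)).
    assert (Hq := Rabs_pos (Ia - / x ^ S a)). nra.
Qed.

(** The square of e^(N/4) >= 1 + N/4 >= (N + 1)/4 yields the constant 16. *)
Lemma exp_half_le N : (INR N + 1) * exp (- INR N / 2) <= 16 * / INR (S N).
Proof.
  assert (HN := pos_INR N). assert (H := exp_ineq1_le (INR N / 4)).
  replace (- INR N / 2) with (- (INR N / 4 + INR N / 4)) by field.
  rewrite exp_Ropp, exp_plus, S_INR.
  set (e := exp (INR N / 4)) in *.
  apply Rmult_le_reg_r with (e * e * (INR N + 1)); [nra|].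
  replace ((INR N + 1) * / (e * e) * (e * e * (INR N + 1))) with ((INR N + 1) * (INR N + 1)) by (field; nra).
  replace (16 * / (INR N + 1) * (e * e * (INR N + 1))) with (16 * (e * e)) by (field; lra).
  nra.
Qed.

(** After integration by parts the Poisson kernel is replaced by its truncated expansion, whose
    terms integrate to 1/n^(2i+1) up to incomplete gamma tails. All errors are uniform in w >= 0. *)
Lemma kappa_transform_sine_sum i : exists C, forall N w, 0 <= w ->
  Rabs (RInt (fun t => mono (2 * i + 1) t * kappa t w) 0 (INR N) * cosh w - sine_sum N i (gd w))
    <= C * / INR (S N).
Proof.
  set (a := (2 * i)%nat).
  (* The three summands bound the integrated Poisson remainder, the N incomplete gamma errors and
     the boundary term at t = N. *)
  exists (2 ^ S a * 4 + 2 * (2 ^ S a * 16) + 2 ^ S a * 2 * 16).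
  intros N w Hw. assert (HN := pos_INR N).
  rewrite !Rmult_plus_distr_r.
  rewrite Nat.add_1_r. rewrite RInt_mono_kappa.
  assert (H2 : 0 < 2 ^ S a) by (apply pow_lt; lra).
  set (f := fun t => mono a t * poisson_sum N t (gd w)).
  set (r := fun t => mono a t * (poisson t w - poisson_sum N t (gd w))).
  assert (Hf : is_RInt f 0 (INR N) (2 * bsum N (fun n => (-1) ^ n * sin (INR (S n) * gd w) *
     RInt (fun t => mono a t * exp (- INR (S n) * t)) 0 (INR N)))).
  { apply (is_RInt_ext (fun t => scal 2 (bsum N (fun n => (-1) ^ n * sin (INR (S n) * gd w) *
       (mono a t * exp (- INR (S n) * t)))))).
    - intros t _; unfold f, poisson_sum, scal; simpl; unfold mult; simpl.
      rewrite <- !bsum_scal. apply bsum_ext; intros n _; ring.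
    - apply (is_RInt_scal (V := R_NormedModule)).
      apply (is_RInt_bsum N (fun n t => (-1) ^ n * sin (INR (S n) * gd w) * (mono a t * exp (- INR (S n) * t)))).
      intros n _. apply (is_RInt_scal (V := R_NormedModule) (fun t => mono a t * exp (- INR (S n) * t))).
      apply (RInt_correct (V := R_CompleteNormedModule)), ex_RInt_of_ex_derive, ex_derive_mono_exp. }
  assert (Dr : forall t, ex_derive r t).
  { intros t; apply (ex_derive_mult (mono a)); [apply ex_derive_mono|].
    apply (ex_derive_minus (fun t => poisson t w)); [eexists; apply is_derive_poisson|].
    apply (ex_derive_scal (fun t => bsum N (fun n => (-1) ^ n * sin (INR (S n) * gd w) * exp (- INR (S n) * t)))).
    eexists; apply (is_derive_bsum N (fun n t => (-1) ^ n * sin (INR (S n) * gd w) * exp (- INR (S n) * t))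
      (fun n => (-1) ^ n * sin (INR (S n) * gd w) * (- INR (S n) * exp (- INR (S n) * t)))).
    intros n _; generalize (INR (S n)) as x; intros x; auto_derive; [trivial|ring]. }
  assert (Er : RInt (fun t => mono a t * poisson t w) 0 (INR N) =
     RInt r 0 (INR N) + 2 * bsum N (fun n => (-1) ^ n * sin (INR (S n) * gd w) *
     RInt (fun t => mono a t * exp (- INR (S n) * t)) 0 (INR N))).
  { rewrite <- (is_RInt_unique _ _ _ _ Hf).
    rewrite (RInt_ext _ (fun t => plus (r t) (f t)))
      by (intros; unfold r, f, plus; simpl; ring).
    apply (RInt_plus (V := R_CompleteNormedModule) r f);
      [now apply ex_RInt_of_ex_derive|eexists; exact Hf]. }
  rewrite Er.
  set (Ir := RInt r 0 (INR N)).
  set (g := fun n => RInt (fun t => mono a t * exp (- INR (S n) * t)) 0 (INR N) - / INR (S n) ^ S a).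
  replace (Ir + 2 * bsum N (fun n => (-1) ^ n * sin (INR (S n) * gd w) *
     RInt (fun t => mono a t * exp (- INR (S n) * t)) 0 (INR N)) -
     mono (S a) (INR N) * poisson (INR N) w - sine_sum N i (gd w)) with
    (Ir + 2 * bsum N (fun n => (-1) ^ n * sin (INR (S n) * gd w) * g n) +
     - (mono (S a) (INR N) * poisson (INR N) w)).
  2:{ unfold sine_sum, g. replace (2 * i + 1)%nat with (S a) by (unfold a; lia).
      rewrite (bsum_ext N (fun n => (-1) ^ n * sin (INR (S n) * gd w) * (_ - _))
        (fun n => (-1) ^ n * sin (INR (S n) * gd w) *
          RInt (fun t => mono a t * exp (- INR (S n) * t)) 0 (INR N) -
          (-1) ^ n * (sin (INR (S n) * gd w) / INR (S n) ^ S a))) by (intros; unfold Rdiv; ring).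
      rewrite bsum_minus; ring. }
  assert (Hexp := exp_half_le N). assert (Hep := exp_pos (- INR N / 2)).
  assert (B1 : Rabs Ir <= 2 ^ S a * 4 * / INR (S N)).
  (* The decay rate N - 1/2 is positive only for N >= 1; at N = 0 the interval is a point. The
     factor 4 is the one forced at N = 1. *)
  { destruct N as [|N'].
    - unfold Ir; simpl INR; rewrite RInt_point. unfold zero; simpl; rewrite Rabs_R0.
      apply Rmult_le_pos; [simpl in H2; lra|rewrite Rinv_1; lra].
    - set (N := S N') in *. assert (HN1 : 1 <= INR N) by apply one_le_INR_S.
      apply Rle_trans with (2 ^ S a / (INR N - / 2)).
      + apply RInt_abs_le_exp; [lra|lra|lra| |].
        * intros t; now apply (ex_derive_continuous r).
        * intros t [Ht _]; unfold r; rewrite Rabs_mult, (Rabs_pos_eq (mono a t)) by now apply mono_nonneg.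
          apply Rle_trans with (2 ^ a * exp (t / 2) * (2 * exp (- INR N * t))).
          -- apply Rmult_le_compat; [now apply mono_nonneg|apply Rabs_pos|now apply mono_le_exp_half|now apply poisson_remainder].
          -- right; rewrite <- tech_pow_Rmult.
             replace (- (INR N - / 2) * t) with (t / 2 + - INR N * t) by field.
             rewrite exp_plus; ring.
      + unfold Rdiv; rewrite Rmult_assoc; apply Rmult_le_compat_l; [lra|].
        replace (4 * / INR (S N)) with (/ (INR (S N) / 4)) by (field; rewrite S_INR; lra).
        apply Rinv_le_contravar; rewrite S_INR; lra. }
  assert (B2 : Rabs (2 * bsum N (fun n => (-1) ^ n * sin (INR (S n) * gd w) * g n))
     <= 2 * (2 ^ S a * 16) * / INR (S N)).
  { rewrite Rabs_mult, Rabs_pos_eq, !Rmult_assoc by lra. apply Rmult_le_compat_l; [lra|].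
    apply Rle_trans with (INR N * (2 ^ S a * exp (- INR N / 2))).
    - eapply Rle_trans; [apply bsum_Rabs|]. rewrite <- bsum_const.
      apply bsum_le; intros n _. rewrite !Rabs_mult, pow_1_abs, Rmult_1_l.
      rewrite <- (Rmult_1_l (2 ^ S a * _)).
      apply Rmult_le_compat; [apply Rabs_pos|apply Rabs_pos|apply Rabs_le, SIN_bound|].
      exact (incomplete_gamma a (INR (S n)) (INR N) (one_le_INR_S n) HN).
    - replace (INR N * (2 ^ S a * exp (- INR N / 2))) with (2 ^ S a * (INR N * exp (- INR N / 2))) by ring.
      apply Rmult_le_compat_l; [lra|]. nra. }
  assert (B3 : Rabs (- (mono (S a) (INR N) * poisson (INR N) w)) <= 2 ^ S a * 2 * 16 * / INR (S N)).
  { rewrite Rabs_Ropp, Rabs_mult. destruct (poisson_bound (INR N) w Hw) as [P1 P2].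
    rewrite (Rabs_pos_eq (mono _ _)), (Rabs_pos_eq (poisson _ _)) by (try assumption; now apply mono_nonneg).
    apply Rle_trans with (2 ^ S a * exp (INR N / 2) * (2 * exp (- INR N))).
    - apply Rmult_le_compat; [now apply mono_nonneg|assumption|now apply mono_le_exp_half|assumption].
    - replace (2 ^ S a * exp (INR N / 2) * (2 * exp (- INR N))) with
        (2 ^ S a * 2 * (exp (- INR N / 2))).
      + rewrite !Rmult_assoc. apply Rmult_le_compat_l; [lra|]. nra.
      + replace (- INR N / 2) with (INR N / 2 + - INR N) by field. rewrite exp_plus; ring. }
  eapply Rle_trans; [apply Rabs_triang|]. apply Rplus_le_compat; [|assumption].
  eapply Rle_trans; [apply Rabs_triang|]. now apply Rplus_le_compat.
Qed.

(** * Conclusion *)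

(** The estimate keeps the factor cosh w so that it is uniform in w; the later division by cosh w
    then supplies the decay required for integration. *)
Lemma gd_power_kappa_transform m : exists eps : nat -> R, is_lim_seq eps 0 /\
  forall N w, 0 <= w ->
  Rabs ((-1) ^ m * mono (2 * m + 1) (gd w) - bsum (S m) (fun i => zcoef (m - i) *
    (RInt (fun t => mono (2 * i + 1) t * kappa t w) 0 (INR N) * cosh w))) <= eps N.
Proof.
  destruct (unif0_zcoef_sine_sum m) as [e [He HP]].
  assert (HQ : forall n, exists C, forall N w, 0 <= w ->
    Rabs (bsum n (fun i => zcoef (m - i) *
      (sine_sum N i (gd w) - RInt (fun t => mono (2 * i + 1) t * kappa t w) 0 (INR N) * cosh w)))
      <= C * / INR (S N)).
  { induction n as [|n [C IH]].
    - exists 0; intros; simpl bsum; rewrite Rabs_R0; lra.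
    - destruct (kappa_transform_sine_sum n) as [C' HC'].
      exists (C + Rabs (zcoef (m - n)) * C'); intros N w Hw; rewrite bsum_S.
      eapply Rle_trans; [apply Rabs_triang|]. rewrite Rmult_plus_distr_r.
      apply Rplus_le_compat; [now apply IH|].
      rewrite Rabs_mult, Rabs_minus_sym, Rmult_assoc.
      apply Rmult_le_compat_l; [apply Rabs_pos|now apply HC']. }
  destruct (HQ (S m)) as [C HC].
  exists (fun N => e N + C * / INR (S N)); split.
  - apply is_lim_seq_plus_0; [assumption|apply is_lim_seq_scal_0, is_lim_seq_inv_INR_S].
  - intros N w Hw.
    match goal with |- Rabs (?a - bsum _ ?f) <= _ => replace (a - bsum (S m) f) with
      (- (zcoef_sine_sum N m (gd w) - a) + bsum (S m) (fun i => zcoef (m - i) *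
      (sine_sum N i (gd w) - RInt (fun t => mono (2 * i + 1) t * kappa t w) 0 (INR N) * cosh w))) end.
    + eapply Rle_trans; [apply Rabs_triang|]. rewrite Rabs_Ropp.
      apply Rplus_le_compat; [now apply HP, gd_bounds|now apply HC].
    + rewrite (bsum_ext (S m) (fun i => zcoef (m - i) * (_ - _)) (fun i => zcoef (m - i) * sine_sum N i (gd w) -
        zcoef (m - i) * (RInt (fun t => mono (2 * i + 1) t * kappa t w) 0 (INR N) * cosh w)))
        by (intros; ring).
      rewrite bsum_minus; unfold zcoef_sine_sum; ring.
Qed.

Lemma continuous_bsum n (f : nat -> R -> R) x : (forall i, continuous (f i) x) ->
  continuous (fun y => bsum n (fun i => f i y)) x.
Proof.
  intros H; induction n as [|n IH]; simpl; [apply continuous_const|].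
  now apply (continuous_plus (V := R_NormedModule) (fun y => bsum n (fun i => f i y)) (f n)).
Qed.

(** The preceding approximation of the power of v is integrated against w^(2j+1) / (2j+1)! / cosh w:
    the factor cosh w cancels and leaves moments of [kappa]. The sign of [W_integral] is +1 because
    the depth 2 m + 2 is even. *)
Lemma W_kappa_lim j m : is_lim_seq (fun N => bsum (S m) (fun i => zcoef (m - i) * kappa_moment N (2 * j + 1) (2 * i + 1)))
  ((-1) ^ m * W (2 * j + 1 + (2 * m + 2)) (2 * m + 2)).
Proof.
  set (A := (2 * j + 1)%nat).
  destruct (gd_power_kappa_transform m) as [eps [Heps HE]].
  set (u := fun w => mono (2 * m + 1) (gd w) * / cosh w * mono A w).
  set (k := fun N i w => RInt (fun t => mono A w * (mono (2 * i + 1) t * kappa t w)) 0 (INR N)).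
  assert (Du : forall w, ex_derive u w).
  { intros w; apply (ex_derive_mult (fun w => mono (2 * m + 1) (gd w) * / cosh w)); [|apply ex_derive_mono].
    apply (ex_derive_mult (fun w => mono (2 * m + 1) (gd w)));
      [apply ex_derive_mono_gd|eexists; apply is_derive_inv_cosh]. }
  assert (Ck : forall N i w, continuous (k N i) w).
  { intros N i w; apply continuous_RInt_param, continuity_2d_mono_kappa. }
  set (D := fun N w => (-1) ^ m * u w - bsum (S m) (fun i => zcoef (m - i) * k N i w)).
  assert (ID : forall N, RInt (D N) 0 (INR N) = (-1) ^ m * RInt u 0 (INR N) -
     bsum (S m) (fun i => zcoef (m - i) * kappa_moment N A (2 * i + 1))).
  { intros N; apply is_RInt_unique, (is_RInt_minus (V := R_NormedModule)).
    - apply (is_RInt_scal (V := R_NormedModule) u), (RInt_correct (V := R_CompleteNormedModule)).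
      now apply ex_RInt_of_ex_derive.
    - apply (is_RInt_bsum (S m) (fun i w => zcoef (m - i) * k N i w)); intros i _.
      apply (is_RInt_scal (V := R_NormedModule) (k N i)), (RInt_correct (V := R_CompleteNormedModule)).
      apply (@ex_RInt_continuous R_CompleteNormedModule); intros; apply Ck. }
  assert (HD : is_lim_seq (fun N => RInt (D N) 0 (INR N)) 0).
  (* The weight is at most 2^A e^(w/2) times 2 e^(-w), and e^(-w/2) integrates to at most 2. *)
  { apply is_lim_seq_0_squeeze with (fun N => 2 ^ S A * 2 * eps N); [|now apply is_lim_seq_scal_0].
    intros N.
    assert (H2 : 0 < 2 ^ S A) by (apply pow_lt; lra).
    assert (He : 0 <= eps N) by (eapply Rle_trans; [apply Rabs_pos|apply (HE N 0); lra]).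
    replace (2 ^ S A * 2 * eps N) with (2 ^ S A * eps N / / 2) by field.
    apply RInt_abs_le_exp; [nra|lra|apply pos_INR| |].
    - intros w; apply (continuous_minus (V := R_NormedModule) (fun w => (-1) ^ m * u w)).
      + apply (ex_derive_continuous (fun w => (-1) ^ m * u w)), (ex_derive_scal u), Du.
      + apply (continuous_bsum (S m) (fun i w => zcoef (m - i) * k N i w)); intros i.
        apply (continuous_scal_r (V := R_NormedModule) (zcoef (m - i)) (k N i)), Ck.
    - intros w [Hw _]. specialize (HE N w Hw). assert (Hc := cosh_ge_1 w).
      assert (E : D N w = mono A w * / cosh w * ((-1) ^ m * mono (2 * m + 1) (gd w) - bsum (S m) (fun i => zcoef (m - i) *
        (RInt (fun t => mono (2 * i + 1) t * kappa t w) 0 (INR N) * cosh w)))).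
      { unfold D, u. rewrite Rmult_minus_distr_l, <- bsum_scal. f_equal; [ring|].
        apply bsum_ext; intros i _. unfold k.
        transitivity (zcoef (m - i) * (mono A w * RInt (fun t => mono (2 * i + 1) t * kappa t w) 0 (INR N)));
          [f_equal|field; lra].
        apply (RInt_scal (V := R_CompleteNormedModule) (fun t => mono (2 * i + 1) t * kappa t w)).
        apply (@ex_RInt_continuous R_CompleteNormedModule); intros t _.
        apply (continuous_mult (mono (2 * i + 1)) (fun t => kappa t w)).
        - apply (ex_derive_continuous (mono (2 * i + 1))), ex_derive_mono.
        - apply (continuity_2d_pt_continuous_r (fun w t => kappa t w)), continuity_2d_pt_flip, continuity_2d_kappa. }
      rewrite E, !Rabs_mult.
      assert (Hm := mono_nonneg A w Hw). assert (Hi := inv_cosh_pos w).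
      rewrite (Rabs_pos_eq (mono A w)), (Rabs_pos_eq (/ cosh w)) by lra.
      apply Rle_trans with (2 ^ A * exp (w / 2) * (2 * exp (- w)) * eps N).
      + apply Rmult_le_compat; [nra|apply Rabs_pos| |assumption].
        apply Rmult_le_compat; [lra|lra|now apply mono_le_exp_half|apply inv_cosh_le_exp].
      + right. replace (- / 2 * w) with (w / 2 + - w) by field.
        rewrite exp_plus, <- tech_pow_Rmult; ring. }
  assert (HW := W_integral A (2 * m + 1)).
  replace (S (2 * m + 1)) with (2 * m + 2)%nat in HW by lia.
  assert (HW2 := is_lim_seq_scal_l _ ((-1) ^ m) _ HW).
  assert (H3 := is_lim_seq_minus' _ _ _ _ HW2 HD).
  rewrite Rminus_0_r in H3.
  eapply is_lim_seq_ext; [|exact H3].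
  intros N; cbv beta. rewrite ID. fold u.
  replace ((-1) ^ (2 * m + 2)) with 1; [ring|].
  replace (2 * m + 2)%nat with (2 * (m + 1))%nat by lia. now rewrite pow_1_even.
Qed.

Theorem theorem1p1 : forall m p : nat, (1 <= m)%nat -> (1 <= p)%nat ->
  (-1) ^ m * Rsum_list (map (fun j => W (2 * j + 2 * m - 1) (2 * m) * Zjp j p) (seq 1 p))
  = (-1) ^ p * Rsum_list (map (fun j => W (2 * j + 2 * p - 1) (2 * p) * Zjp j m) (seq 1 m)).
Proof.
  (* All indices are lowered by one so that ranges start at 0; this shift turns (-1)^m into minus
     the sign of the statement. *)
  assert (L : forall m p, is_lim_seq (fun N => bsum (S p) (fun j => zcoef (p - j) *
      bsum (S m) (fun i => zcoef (m - i) * kappa_moment N (2 * j + 1) (2 * i + 1))))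
    (- ((-1) ^ S m * Rsum_list (map (fun j => W (2 * j + 2 * S m - 1) (2 * S m) * Zjp j (S p)) (seq 1 (S p)))))).
  { intros m p.
    rewrite Rsum_list_seq, <- tech_pow_Rmult.
    replace (- (-1 * (-1) ^ m * bsum (S p) (fun i => W (2 * (1 + i) + 2 * S m - 1) (2 * S m) * Zjp (1 + i) (S p))))
      with (bsum (S p) (fun j => zcoef (p - j) * ((-1) ^ m * W (2 * j + 1 + (2 * m + 2)) (2 * m + 2)))).
    - apply (is_lim_seq_bsum (S p) (fun j N => zcoef (p - j) *
        bsum (S m) (fun i => zcoef (m - i) * kappa_moment N (2 * j + 1) (2 * i + 1)))).
      intros j _. apply (is_lim_seq_scal_l _ (zcoef (p - j)) _ (W_kappa_lim j m)).
    - rewrite <- Ropp_mult_distr_l_reverse, <- bsum_scal.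
      apply bsum_ext; intros j Hj.
      rewrite (Zjp_zcoef (1 + j) (S p)) by lia.
      replace (S p - (1 + j))%nat with (p - j)%nat by lia.
      replace (2 * (1 + j) + 2 * S m - 1)%nat with (2 * j + 1 + (2 * m + 2))%nat by lia.
      replace (2 * S m)%nat with (2 * m + 2)%nat by lia. ring. }
  intros [|m] [|p] Hm Hp; try lia.
  assert (E := L p m).
  (* For each N the truncated double sum is already invariant under exchanging m and p, so both
     sides are limits of one sequence. *)
  apply (is_lim_seq_ext _ (fun N => bsum (S p) (fun j => zcoef (p - j) *
      bsum (S m) (fun i => zcoef (m - i) * kappa_moment N (2 * j + 1) (2 * i + 1))))) in E.
  - apply is_lim_seq_unique in E. assert (E2 := is_lim_seq_unique _ _ (L m p)).
    rewrite E in E2. apply Rbar_finite_eq, Ropp_eq_compat in E2. now rewrite !Ropp_involutive in E2.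
  - intros N.
    rewrite (bsum_ext (S m) _ (fun j => bsum (S p) (fun i => zcoef (m - j) * (zcoef (p - i) * kappa_moment N (2 * j + 1) (2 * i + 1)))))
      by (intros; now rewrite bsum_scal).
    rewrite bsum_swap; apply bsum_ext; intros i _. rewrite <- bsum_scal.
    apply bsum_ext; intros j _. rewrite kappa_moment_sym; ring.
Qed.
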